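(* Consider the problem of minimizing $f(x)$ subject to $Ax=b$, $x\in\mathcal X$, under the basic assumptions and the constant rank constraint qualification stated in the context. Fix initial points $x^0\in\mathcal X$, $z^0\in\mathcal X$, $y^0\in\mathbb R^m$ and constants $p>0$, $\gamma$, $c>0$, $\alpha>0$ satisfying $$p\ge 3L_f,\qquad \gamma\ge 0,\qquad c<\frac{1}{L_f+\gamma\sigma_{\max}^2(A)+p},\qquad \alpha<\frac{c(p-L_f)^2}{4\sigma_{\max}^2(A)}.$$ Then there exists $\beta'>0$ such that for every $\beta\in(0,1]$ with $\beta<\beta'$, the sequence $\{(x^t,y^t,z^t)\}_{t\ge0}$ generated by the Smoothed Proximal ALM has the following properties: 1. Every limit point $(\bar x,\bar y)$ of $\{(x^t,y^t)\}$ is a KKT point of the problem. 2. An $\epsilon$-stationary solution is attained within $\mathcal O(1/\epsilon^2)$ iterations; that is, there is a constant $C>0$ independent of $\epsilon$ such that for every $\epsilon\in(0,1]$ there is an integer $t\le C/\epsilon^2$ for which $x^t$ is an $\epsilon$-stationary solution.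
   Context: **Problem.** Minimize $f(x)$ subject to $Ax=b$, $x\in\mathcal X$, where $A\in\mathbb R^{m\times n}$, $b\in\mathbb R^m$, $f:\mathbb R^n\to\mathbb R$ is smooth (possibly nonconvex), and $\mathcal X=\{x\in\mathbb R^n: h_i(x)\le 0,\ i=m+1,\dots,m+\ell\}$ with $h_i:\mathbb R^n\to\mathbb R$. Norms are Euclidean and $\sigma_{\max}(A)$ is the largest singular value of $A$. **Basic assumptions.** (1) $\mathcal X$ is a compact convex set. (2) $f$ is bounded from below on $\mathcal X$: $f(x)>\underline f>-\infty$ for $x\in\mathcal X$. (3) $\|\nabla f(x)-\nabla f(x')\|\le L_f\|x-x'\|$ for all $x,x'\in\mathcal X$. (4) Each $h_i$ is smooth and convex with $L_h$-Lipschitz-continuous gradient. (5) Slater condition: there is $x$ with $Ax=b$ and $h_i(x)<0$ for all $i\in\{m+1,\dots,m+\ell\}$. **Stationary solutions.** Let $\iota$ be the indicator function of $\mathcal X$ ($0$ on $\mathcal X$, $+\infty$ elsewhere) and $\partial\iota(x)$ its subdifferential. For $\epsilon\ge0$, $x\in\mathcal X$ is an $\epsilon$-stationary solution if there exist $y\in\mathbb R^m$ and $v\in\nabla f(x)+A^Ty+\partial\iota(x)$ with $\|v\|\le\epsilon$ and $\|Ax-b\|\le\epsilon$. $\mathcal X^*$ is the set of all $0$-stationary solutions. A pair $(x,y)$ is a KKT point if there exists $\mu=(\mu_{m+1},\dots,\mu_{m+\ell})$ with $\nabla f(x)+A^Ty+\sum_{i}\mu_i\nabla h_i(x)=0$,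 $Ax=b$, and $h_i(x)\le0$, $\mu_i\ge0$, $\mu_ih_i(x)=0$ for all $i$. **Constant rank constraint qualification (CRCQ).** Let $Q(x)\in\mathbb R^{(m+\ell)\times n}$ be the matrix whose first $m$ rows are the rows of $A$ and whose row $i$ is $\nabla h_i(x)^T$ for $i=m+1,\dots,m+\ell$. For $x\in\mathcal X$ let $\mathcal S_x=\{1,\dots,m\}\cup\{i\in\{m+1,\dots,m+\ell\}:h_i(x)=0\}$. For $\mathcal S\subseteq\{1,\dots,m+\ell\}$ let $Q_{\mathcal S}(x)$ be the row submatrix of $Q(x)$ with rows in $\mathcal S$. CRCQ: for every $x^*\in\mathcal X^*$ and every nonempty $\mathcal S\subseteq\mathcal S_{x^*}$, the rank of $Q_{\mathcal S}(x)$ is constant for $x$ in some neighborhood of $x^*$. **Algorithm (Smoothed Proximal ALM).** Let $K(x,z;y)=f(x)+y^T(Ax-b)+\frac{\gamma}{2}\|Ax-b\|^2+\frac p2\|x-z\|^2$ and let $\mathcal P_{\mathcal X}$ be Euclidean projection onto $\mathcal X$. For $t=0,1,2,\dots$: $$y^{t+1}=y^t+\alpha(Ax^t-b),\quad x^{t+1}=\mathcal P_{\mathcal X}\big(x^t-c\nabla_xK(x^t,z^t;y^{t+1})\big),\quad z^{t+1}=z^t+\beta(x^{t+1}-z^t).$$ *)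

(* Defs.v *)
From HB Require Import structures.
From mathcomp Require Import all_boot all_order all_algebra.
From mathcomp Require Import all_classical all_reals all_analysis.

Set Implicit Arguments.
Unset Strict Implicit.
Unset Printing Implicit Defensive.

Import Order.TTheory GRing.Theory Num.Theory.
Import numFieldNormedType.Exports.

Local Open Scope classical_set_scope.
Local Open Scope ring_scope.

(* Points of R^n are column vectors ['cV[R]_n].  The library norm [`|_|] on matrices is the
   sup norm: it is only used through the topology it induces, which is the
   usual one; all norms in inequalities are the Euclidean norm [enorm]. *)

Section Euclidean.
Variable R : realType.

Definition dotv n (u v : 'cV[R]_n) : R := \sum_(i < n) u i 0 * v i 0.

Definition enorm n (u : 'cV[R]_n) : R := Num.sqrt (dotv u u).

Definition grad n (f : 'cV[R]_n -> R) (x : 'cV[R]_n) : 'cV[R]_n :=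
  \col_(i < n) 'D_(delta_mx i 0) f x.

(* "Smooth" is read as continuously differentiable. *)
Definition smooth n (f : 'cV[R]_n -> R) : Prop :=
  (forall x, differentiable f x) /\ continuous (grad f).

Definition lipschitz_grad n (f : 'cV[R]_n -> R) (L : R)
    (D : set 'cV[R]_n) : Prop :=
  forall x x', D x -> D x' ->
    enorm (grad f x - grad f x') <= L * enorm (x - x').

(* For m < n this may include an extra value 0, which does not affect the
   largest one. *)
Definition singular_value m n (A : 'M[R]_(m, n)) (s : R) : Prop :=
  0 <= s /\ eigenvalue (A^T *m A) (s ^+ 2).

(* There are finitely many singular values, so the supremum is a maximum as
   soon as 0 < n; it is 0 for n = 0. *)
Definition sigma_max m n (A : 'M[R]_(m, n)) : R :=
  sup [set s | singular_value A s].

(* [proj D w] is a point of D at minimal Euclidean distance from w; it exists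
   and is unique when D is nonempty, closed and convex. *)
Definition proj n (D : set 'cV[R]_n) (w : 'cV[R]_n) : 'cV[R]_n :=
  get [set u | D u /\ forall v, D v -> enorm (w - u) <= enorm (w - v)].

Definition indicator n (D : set 'cV[R]_n) (x : 'cV[R]_n) : \bar R :=
  if x \in D then 0%E else +oo%E.

Definition subdifferential n (g : 'cV[R]_n -> \bar R) (x : 'cV[R]_n) :
    set 'cV[R]_n :=
  [set s | forall x', (g x + (dotv s (x' - x))%:E <= g x')%E].

End Euclidean.

Section Problem.
Variables (R : realType) (m n l : nat).
Variables (A : 'M[R]_(m, n)) (b : 'cV[R]_m).
Variables (f : 'cV[R]_n -> R) (h : 'I_l -> 'cV[R]_n -> R).

Definition feasX : set 'cV[R]_n := [set x | forall i, h i x <= 0].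

Definition slater : Prop :=
  exists x, A *m x = b /\ forall i, h i x < 0.

Definition eps_stationary (eps : R) (x : 'cV[R]_n) : Prop :=
  feasX x /\
  exists (y : 'cV[R]_m) (v : 'cV[R]_n),
    [/\ exists2 s, subdifferential (indicator feasX) x s &
          v = grad f x + A^T *m y + s,
        enorm v <= eps & enorm (A *m x - b) <= eps].

Definition stationary_set : set 'cV[R]_n := [set x | eps_stationary 0 x].

Definition KKT_point (x : 'cV[R]_n) (y : 'cV[R]_m) : Prop :=
  exists mu : 'I_l -> R,
    [/\ grad f x + A^T *m y + \sum_(i < l) mu i *: grad (h i) x = 0,
        A *m x = b &
        forall i, [/\ h i x <= 0, 0 <= mu i & mu i * h i x = 0]].

(* Row and constraint indices live in 'I_(m + l): [lshift] for the rows of A,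
   [rshift] for the inequality constraints. *)
Definition Qmx (x : 'cV[R]_n) : 'M[R]_(m + l, n) :=
  col_mx A (\matrix_(i < l) (grad (h i) x)^T).

Definition Qsub (S : {set 'I_(m + l)}) (x : 'cV[R]_n) : 'M[R]_(#|S|, n) :=
  rowsub (fun k : 'I_#|S| => enum_val k) (Qmx x).

Definition active_set (x : 'cV[R]_n) : {set 'I_(m + l)} :=
  finset.finset (fun k : 'I_(m + l) =>
    match fintype.split k with inl _ => true | inr i => h i x == 0 end).

Definition CRCQ : Prop :=
  forall xs, stationary_set xs ->
  forall S : {set 'I_(m + l)}, S != finset.set0 -> S \subset active_set xs ->
  exists r : nat, \forall x \near xs, \rank (Qsub S x) = r.

Definition augK (gamma p : R) (x z : 'cV[R]_n) (y : 'cV[R]_m) : R :=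
  f x + dotv y (A *m x - b) + gamma / 2 * enorm (A *m x - b) ^+ 2
  + p / 2 * enorm (x - z) ^+ 2.

Definition smoothed_prox_ALM (gamma p c alpha beta : R)
    (x0 z0 : 'cV[R]_n) (y0 : 'cV[R]_m)
    (x : nat -> 'cV[R]_n) (y : nat -> 'cV[R]_m) (z : nat -> 'cV[R]_n) : Prop :=
  [/\ x 0%N = x0, y 0%N = y0, z 0%N = z0 &
    forall t,
      [/\ y t.+1 = y t + alpha *: (A *m x t - b),
          x t.+1 = proj feasX
            (x t - c *: grad (fun u => augK gamma p u (z t) (y t.+1)) (x t)) &
          z t.+1 = z t + beta *: (x t.+1 - z t)]].

End Problem.

(* Main.v *)
(* Let d(y, z) be the minimum over X of K(., z; y), attained at x(y, z), and P(z)
   the minimum of f + p/2 |. - z|^2 over the feasible points, attained at x*(z).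
   Along the iterations the potential K - 2 d + 2 P, which is bounded below, drops
   by a multiple of
     |x^{t+1} - x^t|^2 + |A x(y^{t+1}, z^t) - b|^2 + beta |x^{t+1} - z^t|^2,
   up to an error of order beta |x(y^{t+1}, z^t) - x*(z^t)|^2.  When this error is
   not already dominated, all residuals are small with beta, hence z^t is close to
   a stationary point, where the error is absorbed by the dual error bound
   |x(y, z) - x*(z)| <= C |A x(y, z) - b|.

   For the error bound, x(y, z) solves the proximal problem with the right-hand
   side b shifted by r = A x(y, z) - b.  Follow the solutions for s r, 0 <= s <= 1:
   each carries a multiplier supported on linearly independent active rows.  By the
   constant rank condition these rows stay uniformly independent near the
   stationary point, so between two parameters sharing a support the multipliers,
   and then by strong monotonicity the solutions, vary in a Lipschitz way.  There
   are finitely many supports, and the path is continuous by the Slater condition,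
   so it is Lipschitz.  Compactness of X makes the bound uniform. *)

(* Strong convexity alone only gives |x(y, z) - x*(z)|^2 = O(|A x(y, z) - b|), which squared
   residuals cannot absorb; hence the linear error bound. Independence of active gradients at x may
   degenerate as x approaches a stationary point, whereas constant rank transfers it to that point,
   whose left inverses then serve a whole neighbourhood. Supports may switch infinitely often along
   the path, so there is no finite subdivision to sum over; the square-root estimate is the
   continuity that glues the pieces. The weight 2 in the potential: the dual step raises K by alpha
   |A x^t - b|^2 and d by at least alpha <A x^t - b, A x(y^{t+1}, z^t) - b>. Two copies of d turn
   the balance into a gain alpha |A x(y^{t+1}, z^t) - b|^2, less an error of order |x^t - x(y^{t+1},
   z^t)|^2 that the primal step pays for. The potential is bounded below uniformly in y because K >=
   d and P >= d. *)
Require Import Defs.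
From HB Require Import structures.
From mathcomp Require Import all_boot all_order all_algebra.
From mathcomp Require Import all_classical all_reals all_analysis.
From mathcomp Require Import ring lra.

Set Implicit Arguments.
Unset Strict Implicit.
Unset Printing Implicit Defensive.

Import Order.TTheory GRing.Theory Num.Theory.
Import numFieldNormedType.Exports.

Local Open Scope classical_set_scope.
Local Open Scope ring_scope.

(** * Euclidean norm and calculus *)

Section Euclid.
Variable R : realType.
Implicit Types (m n : nat).

Lemma dotvC n (u v : 'cV[R]_n) : dotv u v = dotv v u.
Proof. by apply: eq_bigr => i _; rewrite mulrC. Qed.

Lemma dotvDl n (u v w : 'cV[R]_n) : dotv (u + v) w = dotv u w + dotv v w.
Proof. by rewrite -big_split; apply: eq_bigr => i _; rewrite !mxE mulrDl. Qed.

Lemma dotvZl n a (u v : 'cV[R]_n) : dotv (a *: u) v = a * dotv u v.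
Proof. by rewrite mulr_sumr; apply: eq_bigr => i _; rewrite !mxE mulrA. Qed.

Lemma dotvNl n (u v : 'cV[R]_n) : dotv (- u) v = - dotv u v.
Proof. by rewrite -scaleN1r dotvZl mulN1r. Qed.

Lemma dotvDr n (u v w : 'cV[R]_n) : dotv w (u + v) = dotv w u + dotv w v.
Proof. by rewrite !(dotvC w) dotvDl. Qed.

Lemma dotvZr n a (u v : 'cV[R]_n) : dotv u (a *: v) = a * dotv u v.
Proof. by rewrite !(dotvC u) dotvZl. Qed.

Lemma dotvNr n (u v : 'cV[R]_n) : dotv u (- v) = - dotv u v.
Proof. by rewrite !(dotvC u) dotvNl. Qed.

Lemma dotv0l n (v : 'cV[R]_n) : dotv 0 v = 0.
Proof. by rewrite -(scale0r 0) dotvZl mul0r. Qed.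

Lemma dotv0r n (v : 'cV[R]_n) : dotv v 0 = 0.
Proof. by rewrite dotvC dotv0l. Qed.

Definition dotvE := (dotvDl, dotvDr, dotvNl, dotvNr, dotvZl, dotvZr).

Lemma dotv_suml n (I : finType) (F : I -> 'cV[R]_n) v :
  dotv (\sum_i F i) v = \sum_i dotv (F i) v.
Proof.
by elim/big_rec2: _ => [|i a b _ <-]; rewrite ?dotv0l// dotvDl.
Qed.

Lemma dotv_mulmxl m n (M : 'M[R]_(m, n)) u v :
  dotv (M *m u) v = dotv u (M^T *m v).
Proof.
rewrite /dotv.
under eq_bigr do rewrite mxE mulr_suml.
rewrite exchange_big /=; apply: eq_bigr => i _.
rewrite mxE mulr_sumr; apply: eq_bigr => j _; rewrite mxE; ring.
Qed.

Lemma dotv_trmxl m n (M : 'M[R]_(m, n)) u v :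
  dotv (M^T *m u) v = dotv u (M *m v).
Proof. by rewrite dotv_mulmxl trmxK. Qed.

Lemma dotvv_ge0 n (u : 'cV[R]_n) : 0 <= dotv u u.
Proof. by apply: sumr_ge0 => i _; rewrite -expr2 sqr_ge0. Qed.

Lemma enorm_ge0 n (u : 'cV[R]_n) : 0 <= enorm u.
Proof. exact: sqrtr_ge0. Qed.

Lemma enorm_sqr n (u : 'cV[R]_n) : enorm u ^+ 2 = dotv u u.
Proof. by rewrite sqr_sqrtr// dotvv_ge0. Qed.

Lemma enorm0 n : enorm (0 : 'cV[R]_n) = 0.
Proof. by rewrite /enorm dotv0l sqrtr0. Qed.

Lemma coord_le_enorm n (u : 'cV[R]_n) i : `|u i 0| <= enorm u.
Proof.
rewrite -(@ler_pXn2r _ 2) ?nnegrE ?enorm_ge0// enorm_sqr real_normK ?num_real//.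
by rewrite /dotv (bigD1 i)//= -expr2 lerDl sumr_ge0// => j _; rewrite -expr2 sqr_ge0.
Qed.

Lemma enorm_eq0 n (u : 'cV[R]_n) : enorm u = 0 -> u = 0.
Proof.
move=> u0; apply/matrixP => i j; rewrite (ord1 j) mxE; apply/eqP.
by rewrite -normr_eq0 eq_le normr_ge0 andbT -u0 coord_le_enorm.
Qed.

Lemma enormZ n a (u : 'cV[R]_n) : enorm (a *: u) = `|a| * enorm u.
Proof.
by rewrite /enorm dotvZl dotvZr mulrA -expr2 sqrtrM ?sqr_ge0// sqrtr_sqr.
Qed.

Lemma enormN n (u : 'cV[R]_n) : enorm (- u) = enorm u.
Proof. by rewrite -scaleN1r enormZ normrN1 mul1r. Qed.

Lemma enormBC n (u v : 'cV[R]_n) : enorm (u - v) = enorm (v - u).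
Proof. by rewrite -enormN opprB. Qed.

Lemma dotv_le n (u v : 'cV[R]_n) : dotv u v <= enorm u * enorm v.
Proof.
have [v0|v0] := eqVneq (enorm v) 0.
  by rewrite (enorm_eq0 v0) dotv0r enorm0 mulr0.
have [u0|u0] := eqVneq (enorm u) 0.
  by rewrite (enorm_eq0 u0) dotv0l enorm0 mul0r.
have pu : 0 < enorm u by rewrite lt_def u0 enorm_ge0.
have pv : 0 < enorm v by rewrite lt_def v0 enorm_ge0.
have := dotvv_ge0 (enorm v *: u - enorm u *: v).
rewrite !dotvE -!enorm_sqr (dotvC v u).
set w := (X in 0 <= X).
have -> : w = 2 * (enorm u * enorm v) * (enorm u * enorm v - dotv u v).
  by rewrite /w; ring.
by rewrite pmulr_rge0 ?subr_ge0// !mulr_gt0.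
Qed.

Lemma dotv_ge n (u v : 'cV[R]_n) : - (enorm u * enorm v) <= dotv u v.
Proof. by rewrite lerNl -dotvNl (le_trans (dotv_le _ _))// enormN. Qed.

Lemma enormD n (u v : 'cV[R]_n) : enorm (u + v) <= enorm u + enorm v.
Proof.
rewrite -(@ler_pXn2r _ 2) ?nnegrE ?addr_ge0 ?enorm_ge0//.
rewrite sqrrD !enorm_sqr !dotvE (dotvC v u).
by have := dotv_le u v; lra.
Qed.

Lemma enormB n (u v : 'cV[R]_n) : enorm (u - v) <= enorm u + enorm v.
Proof. by rewrite (le_trans (enormD _ _))// enormN. Qed.

Lemma enorm_triangle n (w u v : 'cV[R]_n) :
  enorm (u - v) <= enorm (u - w) + enorm (w - v).
Proof. by rewrite (le_trans _ (enormD _ _))// addrA subrK. Qed.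

(** Meant for v the image of u under a q-Lipschitz map: a point almost fixed by the map forces
    nearby points to be almost fixed too. *)
Lemma enorm_displacement n (u u' v v' : 'cV[R]_n) q e :
  enorm (v - v') <= q * enorm (u - u') -> enorm (u - v) <= e ->
  enorm (u' - v') <= enorm (u - u') * (1 + q) + e.
Proof.
have := enorm_triangle u u' v'; have := enorm_triangle v u v'.
by rewrite (enormBC u' u); lra.
Qed.

Lemma enorm_sub_le n (u v : 'cV[R]_n) : `|enorm u - enorm v| <= enorm (u - v).
Proof.
have := enormD (u - v) v; have := enormD (v - u) u.
by rewrite !subrK (enormBC v u) ler_norml; lra.
Qed.

Lemma enorm_sum n (I : finType) (F : I -> 'cV[R]_n) :
  enorm (\sum_i F i) <= \sum_i enorm (F i).
Proof.
elim/big_rec2: _ => [|i a b _ le_ab]; first by rewrite enorm0.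
by rewrite (le_trans (enormD _ _))// lerD2l.
Qed.

Lemma enorm_le_sum n (u : 'cV[R]_n) : enorm u <= \sum_i `|u i 0|.
Proof.
have s0 : 0 <= \sum_i `|u i 0| by apply: sumr_ge0.
rewrite -(@ler_pXn2r _ 2) ?nnegrE ?enorm_ge0// enorm_sqr expr2 {1}/dotv mulr_suml.
apply: ler_sum => i _; rewrite (le_trans (ler_norm _))// normrM.
by rewrite ler_wpM2l// (bigD1 i)//= lerDl sumr_ge0.
Qed.

Lemma mulmx_bounded m n (M : 'M[R]_(m, n)) :
  exists2 C, 0 < C & forall v, enorm (M *m v) <= C * enorm v.
Proof.
exists (1 + \sum_i \sum_j `|M i j|).
  by rewrite ltr_pwDl ?ltr01// sumr_ge0// => i _; rewrite sumr_ge0.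
move=> v; apply: (@le_trans _ _ ((\sum_i \sum_j `|M i j|) * enorm v)); last first.
  by rewrite ler_wpM2r ?enorm_ge0// lerDr ler01.
apply: le_trans (enorm_le_sum _) _; rewrite mulr_suml; apply: ler_sum => i _.
rewrite mxE (le_trans (ler_norm_sum _ _ _))// mulr_suml; apply: ler_sum => j _.
by rewrite normrM ler_wpM2l// coord_le_enorm.
Qed.

Lemma norm_le_enorm n (u : 'cV[R]_n) : `|u| <= enorm u.
Proof.
have [n0|/mx_norm_neq0[[i j] e]] := eqVneq (mx_norm u) 0.
  by rewrite [`|u|]n0 enorm_ge0.
by rewrite [`|u|]e (ord1 j) coord_le_enorm.
Qed.

Lemma enorm_le_norm n (u : 'cV[R]_n) : enorm u <= n%:R * `|u|.
Proof.
apply: le_trans (enorm_le_sum _) _.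
rewrite mulr_natl -[X in _ *+ X]card_ord -sumr_const; apply: ler_sum => i _.
rewrite [leRHS]/Num.norm /= mx_normrE.
by apply/bigmax_geP; right; exists (i, 0).
Qed.

(** Norm equivalence: topological statements refer to the sup norm, estimates to the Euclidean one,
    and this is the bridge. *)
Lemma near_enormP n (x0 : 'cV[R]_n) (P : set 'cV[R]_n) :
  (\forall x \near x0, P x) <->
  exists2 e, 0 < e & forall x, enorm (x - x0) < e -> P x.
Proof.
split.
  move=> /nbhs_ballP[e /= e0 eP]; exists e => // x xe; apply: eP.
  by rewrite -ball_normE /= -normrN opprB (le_lt_trans (norm_le_enorm _)).
(* [n.+1] rather than [n] keeps the radius positive in dimension 0. *)
move=> [e e0 eP]; apply/nbhs_ballP; exists (e / n.+1%:R) => /=.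
  by rewrite divr_gt0.
move=> x; rewrite -ball_normE /= => xe; apply: eP.
rewrite enormBC (le_lt_trans (enorm_le_norm _))//.
move: xe; rewrite ltr_pdivlMr// mulrC => /(le_lt_trans _); apply.
by rewrite ler_wpM2r// ler_nat.
Qed.

Lemma lipschitz_enorm_continuous n (g : 'cV[R]_n -> R) C :
  (forall x x', `|g x - g x'| <= C * enorm (x - x')) -> continuous g.
Proof.
move=> gC x; apply/(@cvgrPdist_lt _ _ _ (nbhs x)) => e e0.
apply/near_enormP; exists (e / (`|C| + 1)).
  by rewrite divr_gt0// ltr_wpDl.
move=> x'; rewrite ltr_pdivlMr ?ltr_wpDl// => lt_e.
rewrite (le_lt_trans (gC _ _))// enormBC (le_lt_trans _ lt_e)// mulrC.
by rewrite ler_wpM2l ?enorm_ge0// (le_trans (ler_norm _))// lerDl.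
Qed.

Lemma enorm_affine_continuous m n (M : 'M[R]_(m, n)) (b : 'cV[R]_m) :
  continuous (fun x : 'cV[R]_n => enorm (M *m x - b)).
Proof.
have [C C0 MC] := mulmx_bounded M.
apply: (@lipschitz_enorm_continuous _ _ C) => x x'.
apply: le_trans (enorm_sub_le _ _) _.
by rewrite opprB addrA subrK -mulmxBr MC.
Qed.

Lemma dotv_affine_continuous m n (M : 'M[R]_(m, n)) (b y : 'cV[R]_m) :
  continuous (fun x : 'cV[R]_n => dotv y (M *m x - b)).
Proof.
have [C C0 MC] := mulmx_bounded M.
apply: (@lipschitz_enorm_continuous _ _ (enorm y * C)) => x x'.
rewrite -dotvNr -dotvDr opprB addrA subrK -mulmxBr -mulrA.
have yM := ler_wpM2l (enorm_ge0 y) (MC (x - x')).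
by rewrite ler_norml (le_trans _ (dotv_ge _ _)) ?(le_trans (dotv_le _ _))// lerNl opprK.
Qed.

Lemma enorm_sub_continuous n (z : 'cV[R]_n) :
  continuous (fun x : 'cV[R]_n => enorm (x - z)).
Proof.
apply: (@lipschitz_enorm_continuous _ _ 1) => x x'.
by rewrite mul1r (le_trans (enorm_sub_le _ _))// opprB addrA subrK.
Qed.

Lemma compact_enorm_bounded n (D : set 'cV[R]_n) : compact D ->
  exists2 C, 0 < C & forall x x', D x -> D x' -> enorm (x - x') <= C.
Proof.
move=> /compact_bounded [M [_ MD]].
have M1 : M < `|M| + 1 by rewrite (le_lt_trans (ler_norm _))// ltrDl.
have D1 x : D x -> enorm x <= n.+1%:R * (`|M| + 1).
  move=> Dx; apply: le_trans (enorm_le_norm _) _.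
  by rewrite ler_pM// ?ler_nat// (MD _ M1).
exists (2 * (n.+1%:R * (`|M| + 1))).
  by rewrite !mulr_gt0// ltr_wpDl.
move=> x x' /D1 Dx /D1 Dx'; apply: le_trans (enormB _ _) _; lra.
Qed.

End Euclid.

(** * Convexity, gradients and quadratic bounds along segments *)

Section Calculus.
Variable R : realType.

Lemma convex_setP n (D : set 'cV[R]_n) (x y : 'cV[R]_n) (t : R) :
  @convex_set R 'cV[R]_n D -> D x -> D y -> 0 <= t -> t <= 1 ->
  D (x + t *: (y - x)).
Proof.
move=> cD Dx Dy t0 t1.
have := cD y x (Itv01 t0 t1) (mem_set Dy) (mem_set Dx).
rewrite inE /conv /= /unstable.onem; congr D.
by rewrite scalerBl scale1r scalerBr addrCA.
Qed.

Lemma convex_functionP n (g : 'cV[R]_n -> R) (x y : 'cV[R]_n) (t : R) :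
  @convex_function R 'cV[R]_n setT g -> 0 <= t -> t <= 1 ->
  g (x + t *: (y - x)) <= g x + t * (g y - g x).
Proof.
move=> cg t0 t1.
have h : g (t *: y + (1 - t) *: x) <= t * g y + (1 - t) * g x.
  exact: (cg (Itv01 t0 t1) y x (mem_set I) (mem_set I)).
have -> : x + t *: (y - x) = t *: y + (1 - t) *: x.
  by rewrite scalerBl scale1r scalerBr addrCA.
by lra.
Qed.

Lemma derive_grad n (f : 'cV[R]_n -> R) x d : differentiable f x ->
  'D_d f x = dotv (grad f x) d.
Proof.
move=> df; rewrite deriveE//.
have {1}-> : d = \sum_i d i 0 *: delta_mx i 0.
  rewrite {1}(matrix_sum_delta d); apply: eq_bigr => i _.
  by rewrite big_ord1.
rewrite linear_sum /=; apply: eq_bigr => i _.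
by rewrite linearZ /= !mxE deriveE// mulrC.
Qed.

Lemma is_derive_line n (f : 'cV[R]_n -> R) x d (t : R) :
  differentiable f (x + t *: d) ->
  is_derive t 1 (fun s => f (x + s *: d)) (dotv (grad f (x + t *: d)) d).
Proof.
move=> df.
have E : (fun h : R => h^-1 *: (((fun s => f (x + s *: d)) \o shift t) (h *: 1) - f (x + t *: d)))
   = (fun h : R => h^-1 *: ((f \o shift (x + t *: d)) (h *: d) - f (x + t *: d))).
  apply/funext => h /=; congr (_ *: (f _ - _)).
  by rewrite [h *: 1]mulr1 scalerDl addrCA.
have /(_ d) dfd := diff_derivable df.
apply: DeriveDef; first by rewrite /derivable E.
by rewrite /derive E -derive_grad.
Qed.

Lemma directional_quotient n (f : 'cV[R]_n -> R) x d e :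
  differentiable f x -> 0 < e ->
  exists2 t0, 0 < t0 & forall t, 0 < t -> t < t0 ->
    `|f (x + t *: d) - f x - t * dotv (grad f x) d| <= t * e.
Proof.
move=> df e0.
have /(_ d) dfd := diff_derivable df.
have : (fun h : R => h^-1 *: ((f \o shift x) (h *: d) - f x)) @ 0^'
   --> dotv (grad f x) d by rewrite -derive_grad.
move=> /cvgrPdist_lt /(_ e e0).
rewrite /dnbhs /within /= => /nbhs_ballP[t0 /= t00 Ht]; exists t0 => // t tgt0 tlt.
have := Ht t; rewrite -ball_normE /= sub0r normrN gtr0_norm// => /(_ tlt).
rewrite gt_eqF// => /(_ isT) /ltW le_e.
have -> : f (x + t *: d) - f x - t * dotv (grad f x) d =
    - (t * (dotv (grad f x) d - t^-1 * (f (t *: d + x) - f x))).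
  by rewrite (addrC x) mulrBr mulrA divff ?gt_eqF//; ring.
by rewrite normrN normrM gtr0_norm// ler_pM2l.
Qed.

Lemma convex_grad_le n (g : 'cV[R]_n -> R) x y :
  differentiable g x -> @convex_function R 'cV[R]_n setT g ->
  dotv (grad g x) (y - x) <= g y - g x.
Proof.
move=> dg cg; apply/ler_addgt0Pr => e e0.
have [t0 t00 Ht] := directional_quotient (y - x) dg e0.
pose t := Num.min (t0 / 2) 1.
have tgt0 : 0 < t by rewrite lt_min divr_gt0//=.
have tlt : t < t0 by rewrite gt_min ltr_pdivrMr// mulr_natr mulr2n ltrDl t00.
have t1 : t <= 1 by rewrite ge_min lexx orbT.
have := Ht t tgt0 tlt; rewrite ler_norml => /andP[/= lo _].
have hc := convex_functionP x y cg (ltW tgt0) t1.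
by rewrite -(ler_pM2l tgt0) mulrDr; lra.
Qed.

(** The expansion of [q] along lines is exact, so its directional derivatives are read off the
    coefficients without differentiating norms or matrix products. *)
Lemma grad_add_quadratic n (f q : 'cV[R]_n -> R) x (a : 'cV[R]_n) (c : 'cV[R]_n -> R) :
  differentiable f x ->
  (forall d (t : R), q (x + t *: d) = q x + t * dotv a d + t ^+ 2 * c d) ->
  grad (fun u => f u + q u) x = grad f x + a.
Proof.
move=> df qE; apply/matrixP => i j; rewrite (ord1 j) !mxE.
set d := delta_mx i 0.
suff dq : is_derive x d q (a i 0).
  have [dq1 dq2] := dq.
  have := deriveD (diff_derivable (v := d) df) dq1.
  by rewrite dq2.
have E : (fun h : R => h^-1 *: ((q \o shift x) (h *: d) - q x)) @ 0^' --> a i 0.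
  have ad : dotv a d = a i 0.
    rewrite /dotv (bigD1 i)//= big1 ?addr0 ?/d ?mxE ?eqxx ?mulr1// => k ki.
    by rewrite mxE (negbTE ki) mulr0.
  apply/cvgrPdist_lt => e e0; rewrite /dnbhs /within /=.
  have c1 : 0 < `|c d| + 1 by rewrite ltr_wpDl.
  apply/nbhs_ballP; exists (e / (`|c d| + 1)) => /=; first by rewrite divr_gt0.
  move=> h; rewrite -ball_normE /= sub0r normrN ltr_pdivlMr// => lt_e h0.
  rewrite [_ *: d + x]addrC qE ad.
  have -> : a i 0 - h^-1 *: (q x + h * a i 0 + h ^+ 2 * c d - q x) = - (h * c d).
    by rewrite /GRing.scale /=; field.
  rewrite normrN normrM (le_lt_trans _ lt_e)// ler_wpM2l//.
  by rewrite lerDl.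
by apply: DeriveDef; [exact: cvgP E|exact: cvg_lim E].
Qed.

(** Everything in K but f is quadratic, so the expansion is exact; the gradient of K and both its
    curvature bounds are read off it. *)
Lemma augK_sub m n (A : 'M[R]_(m, n)) b f gamma p u v z y :
  augK A b f gamma p v z y - augK A b f gamma p u z y =
  f v - f u
  + dotv (A^T *m y + gamma *: (A^T *m (A *m u - b)) + p *: (u - z)) (v - u)
  + gamma / 2 * enorm (A *m (v - u)) ^+ 2 + p / 2 * enorm (v - u) ^+ 2.
Proof.
have [d ->] : exists d, v = u + d by exists (v - u); rewrite addrC subrK.
have -> : u + d - u = d by rewrite addrC addKr.
rewrite /augK.
have -> : A *m (u + d) - b = (A *m u - b) + A *m d by rewrite mulmxDr addrAC.
have -> : u + d - z = (u - z) + d by rewrite addrAC.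
move: (A *m u - b) (u - z) => r w.
rewrite !enorm_sqr !dotvE !dotv_trmxl (dotvC d w) (dotvC (A *m d) r).
by field.
Qed.

Lemma grad_augK m n (A : 'M[R]_(m, n)) b f gamma p z y x :
  differentiable f x ->
  grad (fun u => augK A b f gamma p u z y) x =
  grad f x + (A^T *m y + gamma *: (A^T *m (A *m x - b)) + p *: (x - z)).
Proof.
move=> df.
have -> : (fun u => augK A b f gamma p u z y) =
          (fun u => f u + augK A b (fun=> 0) gamma p u z y).
  by apply/funext => u; rewrite /augK; ring.
apply: (@grad_add_quadratic _ _ _ _ _
  (fun d => gamma / 2 * enorm (A *m d) ^+ 2 + p / 2 * enorm d ^+ 2)) => // d t.
have := augK_sub A b (fun=> 0) gamma p x (x + t *: d) z y.
have -> : x + t *: d - x = t *: d by rewrite addrC addKr.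
rewrite !dotvZr -!scalemxAr !enormZ.
rewrite !exprMn real_normK ?num_real//.
by move/eqP; rewrite subr_eq => /eqP ->; ring.
Qed.

(** Mean value theorem for s f along the segment minus its linear term and the claimed quadratic:
    the Lipschitz bound makes the derivative nonpositive. The signs s = 1 and s = -1 give the two
    sides. *)
Lemma smooth_quadratic_bound n (D : set 'cV[R]_n) (f : 'cV[R]_n -> R) L x x' :
  @convex_set R 'cV[R]_n D -> (forall u, differentiable f u) ->
  lipschitz_grad f L D -> D x -> D x' ->
  `|f x' - f x - dotv (grad f x) (x' - x)| <= L / 2 * enorm (x' - x) ^+ 2.
Proof.
move=> cD df Lf Dx Dx'; set d := x' - x.
suff H (s : R) : `|s| <= 1 ->
    s * (f x' - f x - dotv (grad f x) d) <= L / 2 * enorm d ^+ 2.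
  rewrite ler_norml; have := H 1; have := H (-1).
  by rewrite normrN1 normr1 lexx => /(_ isT) + /(_ isT); lra.
move=> s1.
pose g : R -> R := (s *: (fun t => f (x + t *: d)))
  - ((s * dotv (grad f x) d) *: id + (L / 2 * enorm d ^+ 2) *: (id ^+ 2)).
pose dg t := s * dotv (grad f (x + t *: d)) d
  - (s * dotv (grad f x) d + L / 2 * enorm d ^+ 2 * (2 * t)).
have dquad (u : R -> R) (du t a G H : R) : is_derive t 1 u du ->
    is_derive t 1 (a *: u - (G *: id + H *: (id ^+ 2)) : R -> R)
      (a * du - (G + H * (2 * t))).
  move=> hu; have hid := is_derive_id t (1 : R).
  apply: (@is_derive_eq _ _ _ _ _ _ _ _ (is_deriveB (is_deriveZ a hu)
    (is_deriveD (is_deriveZ G hid) (is_deriveZ H (is_deriveX 2 hid))))).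
  by rewrite /GRing.scale /= !mulr1 expr1 mulr_natl.
have dgP (t : R) : is_derive t 1 g (dg t).
  exact: dquad (is_derive_line (df (x + t *: d))).
have [] := @MVT R g dg 0 1 ltr01 (fun t _ => dgP t).
  by apply: derivable_within_continuous => t _; case: (dgP t).
move=> t /[!in_itv]/= /andP[t0 t1].
have xd : x + d = x' by rewrite /d addrC subrK.
rewrite /g !fctE /= scale0r addr0 scale1r xd subr0 mulr1.
rewrite /GRing.scale /= => gE.
have : s * dotv (grad f (x + t *: d) - grad f x) d <= L * t * enorm d ^+ 2.
  apply: le_trans (ler_norm _) _; rewrite normrM.
  apply: (@le_trans _ _ (1 * `|dotv (grad f (x + t *: d) - grad f x) d|)).
    by rewrite ler_wpM2r.
  rewrite mul1r ler_norml.
  have Lt : enorm (grad f (x + t *: d) - grad f x) * enorm d <= L * t * enorm d ^+ 2.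
    rewrite expr2 mulrA ler_wpM2r ?enorm_ge0//.
    have /Lf : D (x + t *: d) by apply: convex_setP => //; exact: ltW.
    by move=> /(_ _ Dx); rewrite [x + _]addrC addrK enormZ gtr0_norm// mulrA.
  by rewrite (le_trans (dotv_le _ _))// (le_trans _ (dotv_ge _ _))// lerNl opprK.
rewrite dotvDl dotvNl; move: gE; rewrite /dg expr0n expr1n /=; nra.
Qed.

End Calculus.

(** * Singular values, minimizers and projections *)

Section Minimizers.
Variable R : realType.

Lemma trmx_continuous m n : continuous (@trmx R m n).
Proof.
move=> M; apply/(@cvgrPdist_lt _ _ _ (nbhs M)) => e e0.
have H : \forall N \near M, `|M - N| < e by apply: (@cvgr_dist_lt _ _ _ (nbhs M)).
apply: filterS H => N; rewrite -linearB /= => /(le_lt_trans _); apply.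
rewrite [leLHS]/Num.norm /= mx_normrE; apply/bigmax_leP; split => //= -[i j] _ /=.
rewrite mxE [leRHS]/Num.norm /= mx_normrE.
by apply/bigmax_geP; right; exists (j, i).
Qed.

Lemma enorm_sphere_compact n : compact [set u : 'cV[R]_n | enorm u = 1].
Proof.
pose S := [set v : 'rV[R]_n | enorm v^T = 1].
have -> : [set u : 'cV[R]_n | enorm u = 1] = trmx @` S.
  apply/seteqP; split => [u /= u1|_ [v /= v1 <-] //].
  by exists u^T; rewrite /S /= ?trmxK.
apply: continuous_compact; first by apply: continuous_subspaceT; exact: trmx_continuous.
apply: bounded_closed_compact.
  exists 1; split => //= M M1 v /= v1; rewrite (le_trans _ (ltW M1))// -v1.
  apply: le_trans (norm_le_enorm _).
  rewrite [leLHS]/Num.norm /= mx_normrE; apply/bigmax_leP; split => //= -[i j] _ /=.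
  rewrite [leRHS]/Num.norm /= mx_normrE.
  by apply/bigmax_geP; right; exists (j, i) => //=; rewrite mxE.
have -> : S = (fun v : 'rV[R]_n => enorm v^T) @^-1` [set 1] by [].
apply: preimage_closed; last exact: closed_eq.
move=> v _; apply: (continuous_comp (@trmx_continuous _ _ v)).
have := @enorm_sub_continuous _ _ (0 : 'cV[R]_n).
by under eq_fun do rewrite subr0; exact.
Qed.

Lemma enorm_sqr_le n k (u : 'cV[R]_n) (v : 'cV[R]_k) :
  (enorm u <= enorm v) = (dotv u u <= dotv v v).
Proof. by rewrite -!enorm_sqr ler_pXn2r// nnegrE enorm_ge0. Qed.

(** A maximizer of |A u| on the unit sphere is an eigenvector of A^T A, so the maximum is itself a
    singular value; it also bounds all the others, which makes the supremum finite. *)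
Lemma sigma_max_le m n (A : 'M[R]_(m, n)) (v : 'cV[R]_n) :
  enorm (A *m v) <= sigma_max A * enorm v.
Proof.
case: n A v => [|n] A v.
  have -> : v = 0 by apply/matrixP => -[].
  by rewrite mulmx0 !enorm0 mulr0.
have S0 : [set u : 'cV[R]_n.+1 | enorm u = 1] !=set0.
  exists (delta_mx 0 0) => /=.
  rewrite /enorm /dotv big_ord_recl big1 ?addr0 ?mxE ?eqxx ?mulr1 ?sqrtr1//.
  by move=> i _; rewrite !mxE /= mulr0.
have := @enorm_affine_continuous _ _ _ A 0; under eq_fun do rewrite subr0.
move=> /continuous_subspaceT /(compact_EVT_max S0 (enorm_sphere_compact (n := n.+1))).
move=> [u /[!inE]/= u1 umax]; set a := dotv (A *m u) (A *m u).
have a0 : 0 <= a := dotvv_ge0 _.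
have amax w : dotv (A *m w) (A *m w) <= a * dotv w w.
  have [->|w0] := eqVneq w 0; first by rewrite mulmx0 !dotv0r mulr0.
  have nw0 : 0 < enorm w.
    by rewrite lt_def enorm_ge0 andbT; apply: contra w0 => /eqP/enorm_eq0 ->.
  have := umax ((enorm w)^-1 *: w); rewrite inE /= enormZ ger0_norm ?invr_ge0 ?enorm_ge0//.
  rewrite mulVf ?gt_eqF// => /(_ erefl).
  rewrite -scalemxAr enorm_sqr_le dotvZl dotvZr -/a mulrA -expr2 exprVn.
  by rewrite mulrC ler_pdivrMr ?exprn_gt0// enorm_sqr.
(* Perturbing the maximizer [u] along the residual [g] of the eigenvalue equation. *)
have au : A^T *m A *m u = a *: u.
  have [g gP] : exists g, g = A^T *m A *m u - a *: u by exists (A^T *m A *m u - a *: u).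
  suff : dotv g g <= 0.
    move=> g0; have : enorm g = 0.
      by apply/eqP; rewrite -sqrf_eq0 enorm_sqr eq_le g0 dotvv_ge0.
    by rewrite gP => /enorm_eq0; exact: subr0_eq.
  (* With this step length the second-order term a |g|^2 / (a + 1)^2 is at most half of the
     first-order gain 2 |g|^2 / (a + 1), which forces g = 0. *)
  have := amax (u + (a + 1)^-1 *: g).
  have gE : dotv g g = dotv (A *m u) (A *m g) - a * dotv u g.
    by rewrite {1}gP dotvDl dotvNl dotvZl -mulmxA dotv_trmxl.
  rewrite mulmxDr -scalemxAr !dotvE -/a (dotvC g u) (dotvC (A *m g)).
  have -> : dotv u u = 1 by rewrite -enorm_sqr u1 expr1n.
  have : dotv (A *m g) (A *m g) >= 0 by exact: dotvv_ge0.
  have a1 : 0 < a + 1 by lra.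
  move: gE (dotvv_ge0 g); set G := dotv g g; set X := dotv (A *m u) _; set Y := dotv u g.
  set Z := dotv (A *m g) _ => GE G0 Z0 H.
  have ai : (a + 1)^-1 * (a + 1) = 1 by rewrite mulVf ?gt_eqF.
  have ai0 : 0 < (a + 1)^-1 by rewrite invr_gt0.
  move: ai ai0 H; set i := (a + 1)^-1 => ai ai0 H.
  have : 2 * i * G <= i * (i * a) * G by move: H Z0; rewrite GE; nra.
  have ia : i * a <= 1 by lra.
  have iG : i * (i * a) * G <= i * 1 * G by rewrite ler_wpM2r// ler_pM2l.
  move=> iG2; have : i * G <= 0 by lra.
  by rewrite pmulr_rle0.
have sa : singular_value A (Num.sqrt a).
  split; first exact: sqrtr_ge0.
  rewrite sqr_sqrtr//; apply/eigenvalueP; exists u^T.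
    by apply: trmx_inj; rewrite !trmx_mul linearZ /= !trmxK au.
  apply/eqP => /(congr1 trmx); rewrite trmxK trmx0 => u0.
  by move: u1; rewrite u0 enorm0 => /eqP; rewrite eq_sym oner_eq0.
have hs : has_sup [set s | singular_value A s].
  split; first by exists (Num.sqrt a).
  exists (Num.sqrt a) => s [s0 /eigenvalueP[w ws w0]].
  have {}ws : A^T *m A *m w^T = s ^+ 2 *: w^T.
    by rewrite -linearZ /= -ws !trmx_mul trmxK.
  have w1 : 0 < dotv w^T w^T.
    rewrite lt_def dotvv_ge0 andbT -enorm_sqr sqrf_eq0.
    by apply: contra w0 => /eqP/enorm_eq0/(congr1 trmx); rewrite trmxK trmx0 => ->.
  rewrite -(ler_sqr (x := s)) ?nnegrE ?sqrtr_ge0// sqr_sqrtr//.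
  rewrite -(ler_pM2r w1) -dotvZl -ws -mulmxA dotv_trmxl; exact: amax.
have : Num.sqrt a <= sigma_max A by apply: sup_upper_bound.
move=> /(ler_wpM2r (enorm_ge0 v)); apply: le_trans.
rewrite -(@ler_pXn2r _ 2) ?nnegrE ?mulr_ge0 ?sqrtr_ge0 ?enorm_ge0//.
by rewrite enorm_sqr exprMn sqr_sqrtr// enorm_sqr.
Qed.

Lemma sigma_max_ge0 m n (A : 'M[R]_(m, n)) : 0 <= sigma_max A.
Proof.
rewrite /sigma_max; set S := [set s | _].
(* Without a supremum, as for the empty set of singular values when n = 0, [sup] takes the value
   0. *)
have [hS|hS] := pselect (has_sup S); last by rewrite sup_out.
have [[s Ss] _] := hS; apply: (@le_trans _ _ s); first by case: Ss.
exact: sup_upper_bound.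
Qed.

Lemma sigma_max_trmx_le m n (A : 'M[R]_(m, n)) (y : 'cV[R]_m) :
  enorm (A^T *m y) <= sigma_max A * enorm y.
Proof.
have [->|h0] := eqVneq (enorm (A^T *m y)) 0.
  by rewrite mulr_ge0 ?sigma_max_ge0 ?enorm_ge0.
have h1 : 0 < enorm (A^T *m y) by rewrite lt_def h0 enorm_ge0.
rewrite -(ler_pM2r h1) -expr2 enorm_sqr dotv_trmxl (le_trans (dotv_le _ _))//.
by rewrite mulrAC mulrC ler_wpM2r ?enorm_ge0 ?sigma_max_le.
Qed.

Definition argmin n (D : set 'cV[R]_n) (G : 'cV[R]_n -> R) : 'cV[R]_n :=
  get [set u | D u /\ forall v, D v -> G u <= G v].

Lemma argminP n (D : set 'cV[R]_n) (G : 'cV[R]_n -> R) :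
  compact D -> D !=set0 -> continuous G ->
  D (argmin D G) /\ forall v, D v -> G (argmin D G) <= G v.
Proof.
move=> cD D0 cG; rewrite /argmin; set P := [set u | _].
suff : exists u, P u by move=> /getPex.
have [u /[!inE] Du umin] := compact_EVT_min D0 cD (continuous_subspaceT cG).
by exists u; split=> // v Dv; apply: umin; rewrite inE.
Qed.

(** A step t towards v changes G by at most t <g, v - u> + t^2 L/2 |v - u|^2, which is negative for
    small t if the first term is. Only this majorant is used, so G is never differentiated. *)
Lemma min_first_order n (D : set 'cV[R]_n) (G : 'cV[R]_n -> R) (g : 'cV[R]_n) L u :
  @convex_set R 'cV[R]_n D -> D u -> (forall v, D v -> G u <= G v) ->
  (forall v, D v -> G v <= G u + dotv g (v - u) + L / 2 * enorm (v - u) ^+ 2) ->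
  forall v, D v -> 0 <= dotv g (v - u).
Proof.
move=> cD Du umin Gup v Dv; rewrite leNgt; apply/negP => neg.
set N := enorm (v - u) ^+ 2.
have N0 : 0 <= N by rewrite sqr_ge0.
pose t := Num.min 1 (- dotv g (v - u) / (`|L| * N + 1)).
have K0 : 0 < `|L| * N + 1 by rewrite ltr_wpDl// mulr_ge0.
have t0 : 0 < t by rewrite lt_min ltr01 divr_gt0// oppr_gt0.
have t1 : t <= 1 by rewrite ge_min lexx.
have tK : t * (`|L| * N + 1) <= - dotv g (v - u).
  by rewrite -ler_pdivlMr// ge_min lexx orbT.
have Dt := convex_setP cD Du Dv (ltW t0) t1.
have := le_trans (umin _ Dt) (Gup _ Dt).
have -> : u + t *: (v - u) - u = t *: (v - u) by rewrite addrC addKr.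
rewrite dotvZr enormZ exprMn real_normK ?num_real// -/N.
have : L * N <= `|L| * N by rewrite ler_wpM2r// ler_norm.
nra.
Qed.

Lemma projP n (D : set 'cV[R]_n) (w : 'cV[R]_n) :
  compact D -> @convex_set R 'cV[R]_n D -> D !=set0 ->
  D (Defs.proj D w) /\ forall v, D v -> dotv (w - Defs.proj D w) (v - Defs.proj D w) <= 0.
Proof.
move=> kD cD D0.
have cG : continuous (fun v : 'cV[R]_n => enorm (w - v)).
  by under eq_fun do rewrite enormBC; exact: enorm_sub_continuous.
have [Du umin] := argminP kD D0 cG; rewrite -[argmin _ _]/(Defs.proj D w) in Du umin.
split=> // v Dv.
have := @min_first_order _ D (fun v => enorm (w - v) ^+ 2) ((-2) *: (w - Defs.proj D w)) 2 _ cD Du.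
have minq v' : D v' -> enorm (w - Defs.proj D w) ^+ 2 <= enorm (w - v') ^+ 2.
  by move=> /umin; rewrite ler_pXn2r ?nnegrE ?enorm_ge0.
move=> /(_ minq) H; have {H} : 0 <= dotv (-2 *: (w - Defs.proj D w)) (v - Defs.proj D w).
  apply: H => // v' _; set q := Defs.proj D w.
  have -> : w - v' = (w - q) - (v' - q) by rewrite opprB addrA subrK.
  move: (w - q) (v' - q) => s d; rewrite !enorm_sqr !dotvE (dotvC d s); lra.
rewrite dotvZl; lra.
Qed.

End Minimizers.

(** * Farkas' lemma and Lagrange multipliers *)

Section Multipliers.
Variable R : realType.

(** Induction on the number of functionals, purely algebraic, so that no closedness of the generated
    cone has to be shown. If the tail does not imply the claim, a witness [x0] has a positive value
    under the first functional, which can then be eliminated. *)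
Lemma farkas_ord n k (a : 'I_k -> 'cV[R]_n) (c : 'cV[R]_n) :
  (forall x, (forall i, dotv (a i) x <= 0) -> dotv c x <= 0) ->
  exists2 w : 'I_k -> R, (forall i, 0 <= w i) & c = \sum_i w i *: a i.
Proof.
elim: k a c => [|k IH] a c H.
  exists (fun=> 0) => //; rewrite big_ord0; apply: enorm_eq0; apply/eqP.
  rewrite -sqrf_eq0 enorm_sqr eq_le dotvv_ge0 andbT; apply: H.
  by move=> [].
have [H'|] := pselect (forall x, (forall i, dotv (a (lift ord0 i)) x <= 0) -> dotv c x <= 0).
  have [w w0 ->] := IH _ _ H'.
  exists (fun i => if unlift ord0 i is Some j then w j else 0).
    by move=> i; case: unliftP.
  rewrite big_ord_recl unlift_none scale0r add0r.
  by apply: eq_bigr => i _; rewrite liftK.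
move=> /existsNP[x0 /not_implyP[ax0 /negP]]; rewrite -ltNge => cx0.
set e := a ord0.
have ex0 : 0 < dotv e x0.
  rewrite ltNge; apply/negP => le0.
  have := H x0; rewrite leNgt cx0 => H0; suff : false by [].
  apply: H0 => i; case: (unliftP ord0 i) => [j ->|->] //; exact: ax0.
pose s := (dotv e x0)^-1.
have s0 : 0 < s by rewrite invr_gt0.
have se : s * dotv e x0 = 1 by rewrite mulVf ?gt_eqF.
(* Bartl's argument: project all functionals along [e] to those vanishing at [x0]. *)
have [x ax|w w0 cE] := IH (fun i => a (lift ord0 i) - (s * dotv (a (lift ord0 i)) x0) *: e)
    (c - (s * dotv c x0) *: e).
  have := H (x - (s * dotv e x) *: x0).
  have E v : dotv v (x - (s * dotv e x) *: x0) = dotv (v - (s * dotv v x0) *: e) x.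
    by rewrite !dotvE; ring.
  rewrite E; apply => i; rewrite E; case: (unliftP ord0 i) => [j ->|->] //.
  rewrite -/e se scale1r subrr dotv0l //.
exists (fun i => if unlift ord0 i is Some j then w j else
    s * dotv c x0 - \sum_j w j * (s * dotv (a (lift ord0 j)) x0)).
  move=> i; case: unliftP => // _.
  rewrite subr_ge0; apply: (@le_trans _ _ 0); last by rewrite mulr_ge0 ?ltW.
  apply: sumr_le0 => j _; apply: mulr_ge0_le0 => //.
  by apply: mulr_ge0_le0 => //; exact: ltW.
rewrite big_ord_recl unlift_none.
rewrite [X in _ + X](eq_bigr (fun j => w j *: a (lift ord0 j))); last first.
  by move=> j _; rewrite liftK.
rewrite -/e -[LHS](subrK ((s * dotv c x0) *: e)) cE.
under [X in X + _]eq_bigr do rewrite scalerBr scalerA.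
by rewrite sumrB scalerBl -scaler_suml addrAC -addrA addrC.
Qed.

Lemma farkas n (I : finType) (a : I -> 'cV[R]_n) (c : 'cV[R]_n) :
  (forall x, (forall i, dotv (a i) x <= 0) -> dotv c x <= 0) ->
  exists2 w : I -> R, (forall i, 0 <= w i) & c = \sum_i w i *: a i.
Proof.
move=> H.
have [x ax|w w0 ->] := @farkas_ord n #|I| (fun k => a (enum_val k)) c.
  by apply: H => i; rewrite -(enum_rankK i).
exists (fun i => w (enum_rank i)) => //.
rewrite [RHS](reindex (@enum_val I I)) /=.
  by apply: eq_bigr => k _; rewrite enum_valK.
by apply: onW_bij; exact: enum_val_bij.
Qed.

(** Farkas' lemma on the active gradients. If some d in the linearized cone had <g, d> < 0, tilting
    it towards the Slater point [u] would make it strictly decrease the active constraints, and a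
    short feasible step along it would contradict the variational inequality. *)
Lemma slater_multipliers m n l (A : 'M[R]_(m, n)) (h : 'I_l -> 'cV[R]_n -> R) x u g :
  (forall i v, differentiable (h i) v) ->
  (forall i, @convex_function R 'cV[R]_n setT (h i)) ->
  feasX h x -> (forall i, h i u < 0) -> A *m u = A *m x ->
  (forall v, feasX h v -> A *m v = A *m x -> 0 <= dotv g (v - x)) ->
  exists (y : 'cV[R]_m) (mu : 'I_l -> R),
    g + A^T *m y + \sum_(i < l) mu i *: grad (h i) x = 0 /\
    forall i, 0 <= mu i /\ mu i * h i x = 0.
Proof.
move=> dh ch Xx hu Au VI.
(* Both signs of each row of A yield free multipliers; an inactive constraint is replaced by the
   zero vector, so its weight can be reset to 0 at the end. *)
pose a (i : 'I_m + 'I_m + 'I_l) : 'cV[R]_n := match i with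
  | inl (inl j) => (row j A)^T
  | inl (inr j) => - (row j A)^T
  | inr i => if h i x == 0 then grad (h i) x else 0 end.
have rowE j d : dotv (row j A)^T d = (A *m d) j 0.
  by rewrite /dotv mxE; apply: eq_bigr => i _; rewrite !mxE.
have [d ad|w w0 gE] := @farkas n _ a (- g).
  have Ad : A *m d = 0.
    apply/matrixP => j k; rewrite (ord1 k) [RHS]mxE -rowE; apply/eqP; rewrite eq_le.
    have /= := ad (inl (inl j)); have /= := ad (inl (inr j)).
    by rewrite dotvNl oppr_le0 => -> ->.
  rewrite dotvNl oppr_le0 leNgt; apply/negP => gd.
  pose N := `|dotv g (u - x)| + 1.
  have N0 : 0 < N by rewrite ltr_wpDl.
  (* The tilt towards [u] may use up at most half of the descent along d. *)
  pose e := - dotv g d / 2 / N.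
  have e0 : 0 < e by rewrite divr_gt0// divr_gt0// oppr_gt0.
  pose d' := d + e *: (u - x).
  have gd' : dotv g d' < 0.
    rewrite dotvDr dotvZr.
    have : e * N = - dotv g d / 2 by rewrite /e divfK ?gt_eqF.
    have : dotv g (u - x) <= `|dotv g (u - x)| := ler_norm _.
    move: e0; rewrite /N; nra.
  have Ad' : A *m d' = 0.
    by rewrite mulmxDr Ad add0r -scalemxAr mulmxBr Au subrr scaler0.
  have near_h i : \forall t \near 0^'+, h i (x + t *: d') <= 0.
    have [hx0|hx0] := eqVneq (h i x) 0.
      have hd' : dotv (grad (h i) x) d' < 0.
        have := ad (inr i); rewrite /= hx0 eqxx => hd.
        rewrite dotvDr dotvZr.
        have := convex_grad_le u (dh i x) (ch i); rewrite hx0 subr0 => le1.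
        have := hu i; nra.
      have e1 : 0 < - dotv (grad (h i) x) d' by rewrite oppr_gt0.
      have [t0 t00 ht] := directional_quotient d' (dh i x) e1.
      near=> t; have := ht t; have -> : 0 < t by [].
      have -> : t < t0 by near: t; exact: nbhs_right_lt.
      by move=> /(_ isT isT); rewrite ler_norml hx0; lra.
    have {}hx0 : h i x < 0 by rewrite lt_neqAle hx0 Xx.
    have [t0 t00 ht] := directional_quotient d' (dh i x) ltr01.
    pose M := `|dotv (grad (h i) x) d'| + 1.
    have M0 : 0 < M by rewrite ltr_wpDl.
    near=> t; have := ht t; have t_gt0 : 0 < t by [].
    rewrite t_gt0; have -> : t < t0 by near: t; exact: nbhs_right_lt.
    have : t < - h i x / M.
      by near: t; apply: nbhs_right_lt; rewrite divr_gt0// oppr_gt0.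
    rewrite ltr_pdivlMr// /M => tM /(_ isT isT); rewrite ler_norml.
    have := ler_norm (dotv (grad (h i) x) d'); nra.
  have [t [tX t0]] : exists t, feasX h (x + t *: d') /\ 0 < t.
    have H : \forall t \near 0^'+, forall i, h i (x + t *: d') <= 0.
      by apply: filter_forall.
    near (0 : R)^'+ => t; exists t; split => //.
    by near: t.
  have := VI _ tX; rewrite mulmxDr -scalemxAr Ad' scaler0 addr0 => /(_ erefl).
  rewrite [x + _]addrC addrK dotvZr; nra.
exists (\col_j (w (inl (inl j)) - w (inl (inr j)))).
exists (fun i => if h i x == 0 then w (inr i) else 0); split; last first.
  by move=> i; case: eqP => [->|_]; rewrite ?mulr0 ?mul0r.
apply/eqP; rewrite -addrA addr_eq0; apply/eqP; rewrite -[g]opprK gE; congr (- _).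
rewrite big_sumType /= big_sumType /=; congr (_ + _).
  rewrite -big_split /=; apply/matrixP => i k; rewrite (ord1 k) summxE mxE.
  by apply: eq_bigr => j _; rewrite !mxE; ring.
by apply: eq_bigr => i _; case: ifP; rewrite ?scale0r ?scaler0.
Unshelve. all: by end_near.
Qed.

End Multipliers.

(** * Multipliers supported on linearly independent rows *)

Section BasicMultipliers.
Variables (R : realType) (m n l : nat).
Variables (A : 'M[R]_(m, n)) (h : 'I_l -> 'cV[R]_n -> R).

Definition csupp k (v : 'cV[R]_k) : {set 'I_k} := finset.finset (fun i => v i 0 != 0).

(** KKT multipliers for an objective with gradient g. Equality and inequality parts are stacked, so
    that supports and row subsets of Q share one index set. *)
Definition multiplier (x g : 'cV[R]_n) (lam : 'cV[R]_(m + l)) : Prop :=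
  g + (Qmx A h x)^T *m lam = 0 /\
  forall i, 0 <= lam (rshift m i) 0 /\ lam (rshift m i) 0 * h i x = 0.

Lemma Qmx_trmx_mul x (lam : 'cV[R]_(m + l)) :
  (Qmx A h x)^T *m lam = A^T *m usubmx lam + \sum_i lam (rshift m i) 0 *: grad (h i) x.
Proof.
rewrite -{1}(vsubmxK lam) /Qmx tr_col_mx mul_row_col; congr (_ + _).
apply/matrixP => i j; rewrite (ord1 j) mxE summxE; apply: eq_bigr => k _.
by rewrite !mxE mulrC.
Qed.

(** Multiplying by this zero-one matrix restricts to S; multiplying by its transpose extends by
    zero. *)
Definition selmx k (S : {set 'I_k}) : 'M[R]_(#|S|, k) :=
  rowsub (fun i : 'I_#|S| => enum_val i) 1%:M.

Lemma Qsub_selmx S x : Qsub A h S x = selmx S *m Qmx A h x.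
Proof. by rewrite /Qsub rowsubE. Qed.

Lemma selmx_trmxE k (S : {set 'I_k}) (u : 'cV[R]_#|S|) j :
  ((selmx S)^T *m u) j 0 = \sum_(i < #|S|) (enum_val i == j)%:R * u i 0.
Proof. by rewrite mxE; apply: eq_bigr => i _; rewrite !mxE. Qed.

Lemma selmxK k (S : {set 'I_k}) (v : 'cV[R]_k) : csupp v \subset S ->
  (selmx S)^T *m (selmx S *m v) = v.
Proof.
move=> /fintype.subsetP vS; apply/matrixP => j i; rewrite (ord1 i) selmx_trmxE {i}.
have E i : (selmx S *m v) i 0 = v (enum_val i) 0.
  by rewrite -rowsubE mxE.
under eq_bigr do rewrite E.
rewrite -(big_enum_val (fun i => (i == j)%:R * v i 0)) /=.
have [jS|jS] := boolP (j \in S).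
  rewrite (bigD1 j)//= eqxx mul1r big1 ?addr0// => i /andP[_ /negbTE ->].
  by rewrite mul0r.
rewrite big1 => [|i iS].
  by apply/esym/eqP; apply: contraNT jS => vj; apply: vS; rewrite inE.
have [ij|] := eqVneq i j; last by rewrite mul0r.
by rewrite -ij iS in jS.
Qed.

Lemma selmx_trmx_supp k (S : {set 'I_k}) (u : 'cV[R]_#|S|) :
  csupp ((selmx S)^T *m u) \subset S.
Proof.
apply/fintype.subsetP => j; rewrite inE selmx_trmxE; apply: contraNT => jS.
rewrite big1// => i _; have [e|] := eqVneq; last by rewrite mul0r.
by move: jS; rewrite -e enum_valP.
Qed.

Lemma selmx_mul_trmx k (S : {set 'I_k}) : selmx S *m (selmx S)^T = 1%:M.
Proof.
apply/matrixP => i j; rewrite mxE (bigD1 (enum_val i))//= !mxE eqxx mul1r.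
rewrite big1 ?addr0 => [|k' ne]; last first.
  by rewrite !mxE eq_sym (negbTE ne) mul0r.
by rewrite (inj_eq enum_val_inj) eq_sym.
Qed.

(* Caratheodory: subtract a null combination of the active rows, scaled so that
   the first multiplier to reach 0 does so. *)
Lemma basic_multiplier x g lam : multiplier x g lam ->
  exists2 lam', multiplier x g lam' & row_free (Qsub A h (csupp lam') x).
Proof.
have [N] := ubnP #|csupp lam|; elim: N lam => // N IH lam; rewrite ltnS => leN M.
have [free|] := boolP (row_free (Qsub A h (csupp lam) x)); first by exists lam.
set S := csupp lam in leN *.
rewrite -kermx_eq0 => /rowV0Pn[u /sub_kermxP uQ u0].
pose w := (selmx S)^T *m u^T.
have wS : csupp w \subset S by exact: selmx_trmx_supp.
have wQ : (Qmx A h x)^T *m w = 0.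
  apply: trmx_inj; rewrite /w mulmxA -!trmx_mul !trmxK trmx0.
  by rewrite -uQ Qsub_selmx.
have w0 : w != 0.
  apply: contra u0 => /eqP w0; apply/eqP/trmx_inj.
  by rewrite trmx0 -[u^T]mul1mx -(selmx_mul_trmx S) -mulmxA -/w w0 mulmx0.
move: w wS wQ w0 => w wS wQ w0.
have [j0 wj0] : exists j, w j 0 != 0.
  apply/existsP; apply: contraNT w0; rewrite negb_exists => /forallP H.
  by apply/eqP/matrixP => i j; rewrite (ord1 j) [RHS]mxE; apply/eqP;
    have := H i; rewrite negbK.
(* The ratios are compared in absolute value: no entry then moves by more than its own size ([tw]),
   which keeps the signs whatever the sign of t. *)
have [j wj jmin] := @arg_minP _ _ _ j0 (fun j => w j 0 != 0) (fun j => `|lam j 0 / w j 0|) wj0.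
pose t := lam j 0 / w j 0; pose lam' := lam - t *: w.
have lamS i : i \notin S -> lam i 0 = 0 by rewrite inE negbK => /eqP.
have wS' i : i \notin S -> w i 0 = 0.
  move=> iS; apply/eqP; apply: contraNT iS => wi.
  by apply: (fintype.subsetP wS); rewrite inE.
have lam'j : lam' j 0 = 0 by rewrite !mxE /t divfK// subrr.
have lam'S i : lam i 0 = 0 -> lam' i 0 = 0.
  move=> l0; rewrite !mxE l0 wS' ?mulr0 ?subrr//.
  by rewrite inE l0 eqxx.
have tw i : `|t * w i 0| <= `|lam i 0|.
  have [->|wi] := eqVneq (w i 0) 0; first by rewrite mulr0 normr0.
  by rewrite normrM -ler_pdivlMr ?normr_gt0// -normf_div jmin.
apply: (IH lam').
  apply: leq_trans leN; apply: proper_card; apply/fintype.properP; split.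
    apply/fintype.subsetP => i; rewrite !inE; apply: contraNneq => /lam'S.
    by move=> ->.
  exists j; last by rewrite inE lam'j eqxx.
  by apply: contraNT wj => /wS' ->.
split.
  by rewrite /lam' mulmxBr -scalemxAr wQ scaler0 subr0; case: M.
move=> i; have [_ /(_ i)[l0 lh]] := M; split.
  have := tw (rshift m i); rewrite (ger0_norm l0) !mxE => /(le_trans (ler_norm _)).
  by rewrite subr_ge0.
move: lh => /eqP; rewrite mulf_eq0 => /orP[/eqP/lam'S ->|/eqP ->].
  by rewrite mul0r.
by rewrite mulr0.
Qed.

End BasicMultipliers.

(* At the right end point [t] of the set where the bound holds, some class
   contains points accumulating at [t] from the right. *)
Lemma piecewise_lipschitz (R : realType) n (T : finType) (E : T -> set R)
    (g : R -> 'cV[R]_n) M C :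
  0 <= M -> 0 < C ->
  (forall s, 0 <= s -> s <= 1 -> exists i, E i s) ->
  (forall i s t, 0 <= s <= 1 -> 0 <= t <= 1 -> E i s -> E i t ->
     enorm (g s - g t) <= M * `|s - t|) ->
  (forall s t, 0 <= s <= 1 -> 0 <= t <= 1 ->
     enorm (g s - g t) ^+ 2 <= C * `|s - t|) ->
  enorm (g 1 - g 0) <= M.
Proof.
move=> M0 C0 cov lip hol.
have near_g s t e : 0 <= s <= 1 -> 0 <= t <= 1 -> 0 < e ->
    C * `|s - t| <= e ^+ 2 -> enorm (g s - g t) <= e.
  move=> s01 t01 e0 /(le_trans (hol _ _ s01 t01)).
  by rewrite ler_pXn2r ?nnegrE ?enorm_ge0 ?(ltW e0).
pose S := [set s | 0 <= s <= 1 /\ enorm (g s - g 0) <= M * s].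
have S0 : S 0 by rewrite /S /= subrr enorm0 mulr0 lexx ler01.
have hS : has_sup S by split; [exists 0|exists 1 => s [/andP[]]].
set t := sup S.
have t0 : 0 <= t by exact: sup_upper_bound.
have t1 : t <= 1 by apply: ge_sup; [exists 0|move=> s [/andP[]]].
have t01 : 0 <= t <= 1 by rewrite t0.
have St : enorm (g t - g 0) <= M * t.
  apply/ler_addgt0Pr => e e0.
  have d0 : 0 < e ^+ 2 / C by rewrite divr_gt0 ?exprn_gt0.
  have [s [s01 Ss] ts] := sup_adherent d0 hS; rewrite -/t in ts.
  have st : s <= t by exact: sup_upper_bound.
  have : enorm (g t - g s) <= e.
    apply: near_g => //; rewrite mulrC -ler_pdivlMr// ger0_norm ?subr_ge0//; lra.
  have := enorm_triangle (g s) (g t) (g 0); have := ler_wpM2l M0 st; lra.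
have [->|tn1] := eqVneq 1 t; first by rewrite (le_trans St)// ler_piMr.
have tlt1 : t < 1 by rewrite lt_neqAle eq_sym tn1.
(* Otherwise each class misses some right neighbourhood of t, and the intersection of finitely many
   of these contains points that no class covers. *)
have [i Hi] : exists i, forall d, 0 < d -> exists s, [/\ t < s, s < t + d, s <= 1 & E i s].
  apply: contrapT => /forallNP H.
  have Hn i : \forall s \near t^'+, ~ E i s.
    have /existsNP[d /not_implyP[d0 Hd]] := H i.
    near=> s => Es; apply: Hd; exists s; split => //.
      by near: s; apply: nbhs_right_lt; rewrite ltrDl.
    by near: s; exact: nbhs_right_le.
  have Hall : \forall s \near t^'+, forall i, ~ E i s by exact: filter_forall.
  near t^'+ => s.
  have [i Es] : exists i, E i s.
    apply: cov; first by rewrite (le_trans t0)// ltW.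
    by near: s; exact: nbhs_right_le.
  have : forall i, ~ E i s by near: s.
  by move=> /(_ i).
have [s [ts _ s1 Es]] := Hi 1 ltr01.
have s01 : 0 <= s <= 1 by rewrite s1 (le_trans t0)// ltW.
(* The point t itself may lie outside the class: s is compared with points s' of the class that tend
   to t, and [hol] gives the continuity of g there. *)
have gst : enorm (g s - g t) <= M * (s - t).
  apply/ler_addgt0Pr => e e0.
  have d0 : 0 < Num.min (e ^+ 2 / C) (s - t).
    by rewrite lt_min divr_gt0 ?exprn_gt0 ?subr_gt0.
  have [s' [ts' + s'1 Es']] := Hi _ d0; rewrite -ltrBlDl lt_min => /andP[s'e s's].
  have s'01 : 0 <= s' <= 1 by rewrite s'1 (le_trans t0)// ltW.
  have := lip i s s' s01 s'01 Es Es'; rewrite ger0_norm; last by lra.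
  have : enorm (g s' - g t) <= e.
    apply: near_g => //; rewrite mulrC -ler_pdivlMr// ger0_norm ?subr_ge0 ?ltW//.
  have := enorm_triangle (g s') (g s) (g t).
  have : M * (s - s') <= M * (s - t) by rewrite ler_wpM2l//; lra.
  lra.
have /(sup_upper_bound hS) : S s.
  split=> //; have := enorm_triangle (g t) (g s) (g 0); lra.
by rewrite -/t leNgt ts.
Unshelve. all: by end_near.
Qed.

(** * Uniform linear independence near a point *)

Section LinearIndependence.
Variables (R : realType) (m n l : nat).
Variables (A : 'M[R]_(m, n)) (h : 'I_l -> 'cV[R]_n -> R) (Lh : R).
Hypothesis h_lipschitz : forall i, lipschitz_grad (h i) Lh setT.

Lemma Qmx_trmx_lipschitz x x' (lam : 'cV[R]_(m + l)) :
  enorm ((Qmx A h x)^T *m lam - (Qmx A h x')^T *m lam) <=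
  l%:R * `|Lh| * enorm (x - x') * enorm lam.
Proof.
rewrite !Qmx_trmx_mul opprD addrACA subrr add0r -sumrB.
apply: le_trans (enorm_sum _) _.
rewrite -!mulrA mulr_natl -[X in _ *+ X]card_ord -sumr_const.
apply: ler_sum => i _; rewrite -scalerBr enormZ [leLHS]mulrC [leRHS]mulrA.
apply: ler_pM; rewrite ?enorm_ge0//; last exact: coord_le_enorm.
apply: le_trans (@h_lipschitz i x x' I I) _.
by rewrite ler_wpM2r ?enorm_ge0// ler_norm.
Qed.

(** The left inverse gives |lam| <= C |Q(xb) lam|, and the perturbation is absorbed once e C (LQ +
    1) <= 1. Radius and lower bound are the same e, and every smaller e is allowed, so that finitely
    many supports can share one. *)
Lemma left_inverse_lower_bound k (Q : 'cV[R]_n -> 'M[R]_(n, k)) LQ M xb : 0 <= LQ ->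
  (forall x lam, enorm (Q xb *m lam - Q x *m lam) <= LQ * enorm (x - xb) * enorm lam) ->
  exists2 e0, 0 < e0 & forall e, 0 < e -> e <= e0 ->
  forall x, enorm (x - xb) <= e -> forall lam, lam = M *m (Q xb *m lam) ->
  e * enorm lam <= enorm (Q x *m lam).
Proof.
move=> LQ0 QL; have [C C0 HC] := mulmx_bounded M.
have K0 : 0 < C * (LQ + 1) by rewrite mulr_gt0// ltr_wpDl.
exists (C * (LQ + 1))^-1; first by rewrite invr_gt0.
move=> e e0 ele x xe lam lamE.
have eC : e * (C * (LQ + 1)) <= 1 by rewrite -ler_pdivlMr// div1r.
have h1 := HC (Q xb *m lam); rewrite -lamE in h1.
have h2 := QL x lam.
have h3 := enormD (Q xb *m lam - Q x *m lam) (Q x *m lam); rewrite subrK in h3.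
have h4 : LQ * enorm (x - xb) * enorm lam <= LQ * e * enorm lam.
  by rewrite ler_wpM2r ?enorm_ge0// ler_wpM2l.
have h5 : enorm lam <= C * (LQ * e * enorm lam + enorm (Q x *m lam)).
  apply: le_trans h1 _; rewrite ler_pM2l//; apply: le_trans h3 _.
  by rewrite lerD2r (le_trans h2 h4).
have h6 : e * (C * (LQ + 1)) * enorm lam <= 1 * enorm lam.
  by rewrite ler_wpM2r ?enorm_ge0.
rewrite -(ler_pM2l C0); lra.
Qed.

Lemma row_free_lower_bound S xb : row_free (Qsub A h S xb) ->
  exists2 e0, 0 < e0 & forall e, 0 < e -> e <= e0 ->
  forall x, enorm (x - xb) <= e -> forall lam, csupp lam \subset S ->
  e * enorm lam <= enorm ((Qmx A h x)^T *m lam).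
Proof.
move=> /row_freeP[B QB].
have lamE lam : csupp lam \subset S ->
    lam = (selmx R S)^T *m B^T *m ((Qmx A h xb)^T *m lam).
  move=> lamS; have := congr1 trmx QB; rewrite Qsub_selmx !trmx_mul trmx1 => BQ.
  rewrite -{1}(selmxK lamS) -mulmxA; congr (_ *m _).
  by rewrite -[in RHS](selmxK lamS) !mulmxA -(mulmxA B^T) BQ mul1mx.
have [||e0 e00 He] := @left_inverse_lower_bound _ (fun x => (Qmx A h x)^T)
    (l%:R * `|Lh|) ((selmx R S)^T *m B^T) xb.
- by rewrite mulr_ge0.
- by move=> x lam; rewrite (enormBC x xb); exact: Qmx_trmx_lipschitz.
exists e0 => // e egt0 ele x xe lam lamS; apply: He => //; exact: lamE.
Qed.

End LinearIndependence.

(** * The error bound *)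

Section Landscape.
Variables (R : realType) (m n l : nat).
Variables (A : 'M[R]_(m, n)) (b : 'cV[R]_m).
Variables (f : 'cV[R]_n -> R) (h : 'I_l -> 'cV[R]_n -> R) (Lf : R).
Hypothesis Xcompact : compact (feasX h).
Hypothesis Xconvex : @convex_set R 'cV[R]_n (feasX h).
Hypothesis f_diff : forall x, differentiable f x.
Hypothesis f_lipschitz : lipschitz_grad f Lf (feasX h).
Hypothesis Lf_ge0 : 0 <= Lf.
Local Notation X := (feasX h).
Local Notation K gamma p x z y := (augK A b f gamma p x z y).

Definition gradK gamma p (x z : 'cV[R]_n) (y : 'cV[R]_m) : 'cV[R]_n :=
  grad f x + (A^T *m y + gamma *: (A^T *m (A *m x - b)) + p *: (x - z)).

Lemma augK_continuous gamma p z y : continuous (fun x => K gamma p x z y).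
Proof.
move=> x; rewrite /augK.
apply: (@cvgD _ _ _ (nbhs x)); last first.
  apply: (@cvgMl_tmp _ _ (nbhs x)).
  by apply: (@cvgM _ _ (nbhs x)); exact: enorm_sub_continuous.
apply: (@cvgD _ _ _ (nbhs x)); last first.
  apply: (@cvgMl_tmp _ _ (nbhs x)).
  by apply: (@cvgM _ _ (nbhs x)); exact: enorm_affine_continuous.
apply: (@cvgD _ _ _ (nbhs x)); last exact: dotv_affine_continuous.
exact: differentiable_continuous.
Qed.

(** The curvature of f is at least -Lf, which the proximal term outweighs once p > Lf: this is the
    strong convexity of K on X. *)
Lemma augK_lower gamma p z y u v : 0 <= gamma -> X u -> X v ->
  K gamma p u z y + dotv (gradK gamma p u z y) (v - u)
  + (p - Lf) / 2 * enorm (v - u) ^+ 2 <= K gamma p v z y.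
Proof.
move=> g0 Xu Xv; have := augK_sub A b f gamma p u v z y.
have := smooth_quadratic_bound Xconvex f_diff f_lipschitz Xu Xv.
have : 0 <= gamma / 2 * enorm (A *m (v - u)) ^+ 2.
  by rewrite mulr_ge0 ?sqr_ge0 ?divr_ge0.
rewrite ler_norml /gradK (dotvDl (grad f u)); lra.
Qed.

Lemma augK_upper gamma p z y u v : 0 <= gamma -> X u -> X v ->
  K gamma p v z y <= K gamma p u z y + dotv (gradK gamma p u z y) (v - u)
  + (Lf + gamma * sigma_max A ^+ 2 + p) / 2 * enorm (v - u) ^+ 2.
Proof.
move=> g0 Xu Xv; have := augK_sub A b f gamma p u v z y.
have := smooth_quadratic_bound Xconvex f_diff f_lipschitz Xu Xv.
have : gamma / 2 * enorm (A *m (v - u)) ^+ 2 <=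
       gamma / 2 * (sigma_max A ^+ 2 * enorm (v - u) ^+ 2).
  rewrite ler_wpM2l ?divr_ge0// -exprMn ler_pXn2r ?nnegrE ?mulr_ge0 ?enorm_ge0//.
    exact: sigma_max_le.
  exact: sigma_max_ge0.
rewrite ler_norml /gradK (dotvDl (grad f u)); lra.
Qed.

(** A general convex subset D, because it has to serve both X and the slices A x = b + r. *)
Lemma augK_min_gradient (D : set 'cV[R]_n) gamma p z y u : 0 <= gamma ->
  @convex_set R 'cV[R]_n D -> D `<=` X -> D u ->
  (forall v, D v -> K gamma p u z y <= K gamma p v z y) ->
  forall v, D v -> 0 <= dotv (gradK gamma p u z y) (v - u).
Proof.
move=> g0 cD DX Du umin.
apply: (min_first_order (L := Lf + gamma * sigma_max A ^+ 2 + p) cD Du umin).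
by move=> v Dv; apply: augK_upper; [|exact: DX|exact: DX].
Qed.

Lemma augK_min_growth (D : set 'cV[R]_n) gamma p z y u v : 0 <= gamma ->
  @convex_set R 'cV[R]_n D -> D `<=` X -> D u ->
  (forall v, D v -> K gamma p u z y <= K gamma p v z y) -> D v ->
  K gamma p u z y + (p - Lf) / 2 * enorm (v - u) ^+ 2 <= K gamma p v z y.
Proof.
move=> g0 cD DX Du umin Dv.
have := augK_min_gradient g0 cD DX Du umin Dv.
have := augK_lower p z y g0 (DX _ Du) (DX _ Dv); lra.
Qed.

(** In the sum of the two growth inequalities all of K cancels except the cross term p <z - z', u -
    u'>. *)
Lemma augK_min_lipschitz (D : set 'cV[R]_n) gamma p z z' y u u' :
  0 <= gamma -> 0 <= p -> Lf < p ->
  @convex_set R 'cV[R]_n D -> D `<=` X -> D u -> D u' ->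
  (forall v, D v -> K gamma p u z y <= K gamma p v z y) ->
  (forall v, D v -> K gamma p u' z' y <= K gamma p v z' y) ->
  enorm (u - u') <= p / (p - Lf) * enorm (z - z').
Proof.
move=> g0 p0 Lp cD DX Du Du' umin u'min.
have h1 := augK_min_growth g0 cD DX Du umin Du'.
have h2 := augK_min_growth g0 cD DX Du' u'min Du.
have mu0 : 0 < p - Lf by rewrite subr_gt0.
have [u0|u0] := eqVneq (enorm (u - u')) 0.
  by rewrite u0 mulr_ge0 ?enorm_ge0// divr_ge0// ltW.
have {}u0 : 0 < enorm (u - u') by rewrite lt_def u0 enorm_ge0.
rewrite mulrAC ler_pdivlMr// mulrC -(ler_pM2r u0) -!mulrA.
apply: (@le_trans _ _ (p * dotv (z - z') (u - u'))); last first.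
  by rewrite ler_wpM2l// dotv_le.
rewrite -expr2.
move: h1 h2; rewrite (enormBC u' u) /augK !enorm_sqr !dotvE.
rewrite (dotvC z u) (dotvC z u') (dotvC z' u) (dotvC z' u') (dotvC u' u).
lra.
Qed.

Definition slice (r : 'cV[R]_m) : set 'cV[R]_n := [set x | X x /\ A *m x = b + r].

Lemma slice_sub r : slice r `<=` X. Proof. by move=> x []. Qed.

Lemma slice_convex r : @convex_set R 'cV[R]_n (slice r).
Proof.
move=> x y t /[!inE] -[Xx Ax] [Xy Ay]; split.
  by have := Xconvex t (mem_set Xx) (mem_set Xy); rewrite inE.
rewrite /conv /= mulmxDr -!scalemxAr Ax Ay -scalerDl /unstable.onem.
by rewrite addrC subrK scale1r.
Qed.

Lemma slice_compact r : compact (slice r).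
Proof.
have -> : slice r = X `&` (fun x => enorm (A *m x - (b + r))) @^-1` [set 0].
  apply/seteqP; split => x /= [Xx Ax]; split => //.
    by rewrite Ax subrr enorm0.
  by apply: subr0_eq; exact: enorm_eq0.
apply: subclosed_compact; [|exact: Xcompact|by move=> x []].
apply: closedI; first exact: (compact_closed _ Xcompact).
by apply: preimage_closed; [move=> x _; exact: enorm_affine_continuous|exact: closed_eq].
Qed.

(* [primal p 0 z] is x*(z), and [dualx gamma p y z] below is x(y, z); with a zero
   multiplier and [gamma = 0], [K] is the proximal objective f + p/2 |. - z|^2. *)
Definition primal p r z : 'cV[R]_n := argmin (slice r) (fun x => K 0 p x z 0).

Lemma primalP p r z : slice r !=set0 ->
  slice r (primal p r z) /\
  forall v, slice r v -> K 0 p (primal p r z) z 0 <= K 0 p v z 0.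
Proof.
by move=> r0; apply: argminP => //; [exact: slice_compact|exact: augK_continuous].
Qed.

Definition dualx gamma p y z : 'cV[R]_n := argmin X (fun x => K gamma p x z y).

Lemma dualxP gamma p y z : X !=set0 ->
  X (dualx gamma p y z) /\
  forall v, X v -> K gamma p (dualx gamma p y z) z y <= K gamma p v z y.
Proof. by move=> X0; apply: argminP => //; exact: augK_continuous. Qed.

(* A minimizer of [K] is the minimizer of [f + p/2 |. - z|^2] among the points
   with the same residual: the terms in [A x - b] are constant there. *)
Lemma dualx_primal gamma p y z : 0 <= gamma -> Lf < p -> X !=set0 ->
  dualx gamma p y z = primal p (A *m dualx gamma p y z - b) z.
Proof.
move=> g0 Lp X0; have [Xd dmin] := dualxP gamma p y z X0.
set x1 := dualx gamma p y z in Xd dmin *; set r := A *m x1 - b.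
have Sx : slice r x1 by split=> //; rewrite /r addrC subrK.
have [Sp pmin] := @primalP p r z (ex_intro _ _ Sx).
have := augK_min_growth (lexx 0) (@slice_convex r) (@slice_sub r) Sp pmin Sx.
have : K 0 p x1 z 0 <= K 0 p (primal p r z) z 0.
  have := dmin _ (slice_sub Sp); have [_ Ap] := Sp; have [_ Ax] := Sx.
  by rewrite /augK Ap Ax; lra.
have mu0 : 0 < (p - Lf) / 2 by rewrite divr_gt0// subr_gt0.
move=> le1 le2.
have : (p - Lf) / 2 * enorm (x1 - primal p r z) ^+ 2 <= 0 by lra.
rewrite pmulr_rle0// => le0.
apply: subr0_eq; apply: enorm_eq0; apply/eqP; rewrite -sqrf_eq0 eq_le le0.
exact: sqr_ge0.
Qed.

(** * Stability of the slices under the Slater condition *)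

Hypothesis h_diff : forall i x, differentiable (h i) x.
Hypothesis h_slater : slater A b h.

Lemma slater_ball x : (forall i, h i x < 0) ->
  \forall w \near x, forall i : 'I_l, h i w < 0.
Proof.
move=> hx; apply: (@filter_forall _ _ (fun i w => h i w < 0) (nbhs x)) => i.
have ci := differentiable_continuous (h_diff i x).
exact: (@cvgr_lt R _ (nbhs x) _ (h i) (h i x) ci 0 (hx i)).
Qed.

(** The rows of A may be dependent, so the preimage comes from a generalized inverse, which inverts
    A on its range. *)
Lemma preimage_bounded : exists2 C, 0 < C &
  forall d, exists2 v, A *m v = A *m d & enorm v <= C * enorm (A *m d).
Proof.
have [C C0 HC] := mulmx_bounded (pinvmx A^T)^T.
exists C => // d; exists ((pinvmx A^T)^T *m (A *m d)); last exact: HC.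
apply: trmx_inj; rewrite trmx_mul (trmx_mul _ (A *m d)) trmxK mulmxKpV//.
rewrite trmx_mul.
exact: submxMl.
Qed.

(** The Slater point is translated by a short preimage of r; [x] certifies that r lies in the range
    of A. *)
Lemma slater_shift : exists2 rho, 0 < rho & forall r x, A *m x = b + r ->
  enorm r <= rho -> exists2 u, A *m u = b + r & forall i, h i u < 0.
Proof.
have [xs [Axs hxs]] := h_slater.
have /near_enormP[e e0 eh] := slater_ball hxs.
have [C C0 AC] := preimage_bounded.
exists (e / (2 * C)); first by rewrite divr_gt0// mulr_gt0.
move=> r x Ax re; have [v Av vC] := AC (x - xs).
have rE : A *m (x - xs) = r by rewrite mulmxBr Ax Axs addrC addKr.
exists (xs + v); first by rewrite mulmxDr Av rE Axs.
apply: eh; rewrite addrC addKr (le_lt_trans vC)// rE.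
rewrite (@le_lt_trans _ _ (C * (e / (2 * C))))// ?ler_pM2l//.
have -> : C * (e / (2 * C)) = e / 2 by field; rewrite gt_eqF.
by rewrite ltr_pdivrMr// mulr_natr mulr2n ltrDl.
Qed.

(* Move [x] towards a Slater point whose residual overshoots [r'] in the
   direction [r' - r]. *)
Lemma slice_correction : exists rho C, [/\ 0 < rho, 0 < C &
  forall r r' x x', slice r x -> A *m x' = b + r' -> enorm r' <= rho ->
  exists2 w, slice r' w & enorm (w - x) <= C * enorm (r - r')].
Proof.
have [rho rho0 sl] := slater_shift.
have [D D0 XD] := compact_enorm_bounded Xcompact.
exists (rho / 2), (D / (rho / 2)); split; rewrite ?divr_gt0//.
move=> r r' x x' [Xx Ax] Ax' r'rho.
have [rr|rr] := eqVneq (enorm (r' - r)) 0.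
  have -> : r' = r by apply: subr0_eq; exact: enorm_eq0.
  by exists x; rewrite ?subrr ?enorm0 ?mulr0.
have q0 : 0 < enorm (r' - r) by rewrite lt_def rr enorm_ge0.
(* The overshoot th (r' - r) has length rho/2, so the residual of the target stays within the range
   of [slater_shift]. *)
set q := enorm (r' - r) in q0 rr *; set th := rho / 2 / q.
have th0 : 0 < th by rewrite !divr_gt0.
have thq : th * q = rho / 2 by rewrite /th divfK.
have Ax'' : A *m (x' + th *: (x' - x)) = b + (r' + th *: (r' - r)).
  rewrite mulmxDr -scalemxAr mulmxBr Ax Ax' -addrA.
  by congr (_ + (_ + _ *: _)); rewrite opprD addrACA subrr add0r.
have [|u Au hu] := sl _ _ Ax''.
  rewrite (le_trans (enormD _ _))// enormZ gtr0_norm// -/q thq; lra.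
have Xu : X u by move=> i; exact: ltW.
(* This weight lands exactly on the residual r'; moreover t <= 1/th = q / (rho/2), which makes the
   displacement linear in q. *)
pose t := (1 + th)^-1.
have t0 : 0 < t by rewrite invr_gt0; lra.
have t1 : t <= 1 by rewrite invf_le1; lra.
have tth : t * (1 + th) = 1 by rewrite mulVf// gt_eqF//; lra.
exists (x + t *: (u - x)).
  split; first by apply: convex_setP => //; exact: ltW.
  have E : b + (r' + th *: (r' - r)) - (b + r) = (1 + th) *: (r' - r).
    by rewrite opprD addrACA subrr add0r addrAC scalerDl scale1r.
  rewrite mulmxDr -scalemxAr mulmxBr Ax Au E scalerA tth scale1r.
  by rewrite -addrA; congr (_ + _); rewrite addrC subrK.
rewrite addrC addKr enormZ gtr0_norm// enormBC -/q.
rewrite (le_trans (ler_wpM2l (ltW t0) (XD _ _ Xu Xx)))//.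
rewrite mulrC -mulrA ler_pM2l//.
rewrite mulrC ler_pdivlMr ?divr_gt0// -thq mulrA -[leRHS]mul1r ler_pM2r//.
lra.
Qed.

(* Otherwise unification unfolds these when comparing them at distinct points. *)
#[local] Opaque primal dualx grad enorm.

Variable p : R.
Hypothesis p_gt0 : 0 < p.
Hypothesis Lf_lt : Lf < p.
Local Notation F x z := (augK A b f 0 p x z 0).
Local Notation gF x z := (gradK 0 p x z 0).
Local Notation xs r z := (primal p r z).

Lemma gradK0E x z : gF x z = grad f x + p *: (x - z).
Proof. by rewrite /gradK mulmx0 scale0r !add0r. Qed.

Lemma feasX_nonempty : X !=set0.
Proof. by have [x [_ hx]] := h_slater; exists x => i; exact: ltW. Qed.

Lemma slice0_nonempty : slice 0 !=set0.
Proof.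
have [x [Ax hx]] := h_slater; exists x; split; last by rewrite addr0.
by move=> i; exact: ltW.
Qed.

Lemma gradK0_bounded :
  exists2 G, 0 < G & forall x z, X x -> X z -> enorm (gF x z) <= G.
Proof.
have [D D0 XD] := compact_enorm_bounded Xcompact.
have [x0 Xx0] := feasX_nonempty.
exists (enorm (grad f x0) + Lf * D + p * D + 1) => [|x z Xx Xz].
  have := mulr_ge0 Lf_ge0 (ltW D0); have := mulr_gt0 p_gt0 D0.
  by have := enorm_ge0 (grad f x0); lra.
rewrite gradK0E -(subrK (grad f x0) (grad f x)).
have := enormD (grad f x - grad f x0 + grad f x0) (p *: (x - z)).
have := enormD (grad f x - grad f x0) (grad f x0).
rewrite enormZ gtr0_norm//.
have := f_lipschitz Xx Xx0; have := ler_wpM2l Lf_ge0 (XD _ _ Xx Xx0).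
have := ler_wpM2l (ltW p_gt0) (XD _ _ Xx Xz); lra.
Qed.

Lemma augK0_lipschitz : exists2 C, 0 < C &
  forall x x' z, X x -> X x' -> X z -> F x' z <= F x z + C * enorm (x' - x).
Proof.
have [D D0 XD] := compact_enorm_bounded Xcompact.
have [G G0 FG] := gradK0_bounded.
exists (G + (Lf + p) / 2 * D) => [|x x' z Xx Xx' Xz].
  by rewrite ltr_wpDr// mulr_ge0 ?divr_ge0 ?addr_ge0 ?(ltW p_gt0) ?(ltW D0).
have := augK_upper p z 0 (lexx 0) Xx Xx'; rewrite mul0r addr0 => /le_trans; apply.
have := dotv_le (gF x z) (x' - x).
have := ler_wpM2r (enorm_ge0 (x' - x)) (FG _ _ Xx Xz).
have : (Lf + p) / 2 * enorm (x' - x) ^+ 2 <= (Lf + p) / 2 * (D * enorm (x' - x)).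
  rewrite ler_wpM2l ?divr_ge0 ?addr_ge0 ?(ltW p_gt0)//.
  by rewrite expr2 ler_wpM2r ?enorm_ge0 ?XD.
lra.
Qed.

(* Both minimizers can be corrected into the slice of the other, at a cost
   proportional to the distance of the residuals; strong convexity then loses a
   square root. *)
Lemma primal_holder : exists rho C, [/\ 0 < rho, 0 < C &
  forall r r' z, X z -> slice r !=set0 -> slice r' !=set0 ->
  enorm r <= rho -> enorm r' <= rho ->
  enorm (xs r z - xs r' z) ^+ 2 <= C * enorm (r - r')].
Proof.
have [rho [C [rho0 C0 corr]]] := slice_correction.
have [D D0 XD] := compact_enorm_bounded Xcompact.
have [M M0 FM] := augK0_lipschitz.
have mu0 : 0 < p - Lf by rewrite subr_gt0.
exists rho, (8 * M * C / (p - Lf) + 2 * (2 * D) * C); split => //.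
  by rewrite addr_gt0// ?divr_gt0// !mulr_gt0.
move=> r r' z Xz S S' rr rr'.
have [Sx xmin] := primalP p z S; have [Sx' x'min] := primalP p z S'.
set x := xs r z in Sx xmin *; set x' := xs r' z in Sx' x'min *.
have [w Sw wx] := corr _ _ _ _ Sx (proj2 Sx') rr'.
have [w' Sw' w'x'] := corr _ _ _ _ Sx' (proj2 Sx) rr.
have g1 := augK_min_growth (lexx 0) (@slice_convex r') (@slice_sub r') Sx' x'min Sw.
have g2 := xmin _ Sw'.
have g3 := FM _ _ _ (slice_sub Sx) (slice_sub Sw) Xz.
have g4 := FM _ _ _ (slice_sub Sx') (slice_sub Sw') Xz.
have g5 := ler_wpM2l (ltW M0) wx; have g6 := ler_wpM2l (ltW M0) w'x'.
rewrite (enormBC r') in g6.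
have g7 : enorm (x - x') ^+ 2 <= 2 * enorm (w - x') ^+ 2 + 2 * enorm (w - x) ^+ 2.
  have -> : x - x' = (w - x') - (w - x) by rewrite opprB [RHS]addrC subrKA.
  rewrite !enorm_sqr; have := dotvv_ge0 ((w - x') + (w - x)).
  move: (w - x') (w - x) => a c; rewrite !dotvE (dotvC c a); lra.
have g8 : enorm (w - x) ^+ 2 <= (2 * D) * (C * enorm (r - r')).
  rewrite expr2; apply: ler_pM; rewrite ?enorm_ge0//.
  by rewrite (le_trans (XD _ _ (slice_sub Sw) (slice_sub Sx)))//; lra.
have g9 : enorm (w - x') ^+ 2 <= 4 * M * C / (p - Lf) * enorm (r - r').
  rewrite mulrAC ler_pdivlMr//; lra.
apply: le_trans g7 _; lra.
Qed.

Lemma primal_lipschitz z z' :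
  enorm (xs 0 z - xs 0 z') <= p / (p - Lf) * enorm (z - z').
Proof.
have [Sx xmin] := primalP p z slice0_nonempty.
have [Sx' x'min] := primalP p z' slice0_nonempty.
exact: (augK_min_lipschitz (lexx 0) (ltW p_gt0) Lf_lt (@slice_convex 0)
  (@slice_sub 0) Sx Sx' xmin x'min).
Qed.

Hypothesis h_convex : forall i, @convex_function R 'cV[R]_n setT (h i).

Lemma primal_multiplier : exists2 rho, 0 < rho & forall r z,
  slice r !=set0 -> enorm r <= rho ->
  exists lam, multiplier A h (xs r z) (gF (xs r z) z) lam.
Proof.
have [rho rho0 sl] := slater_shift.
exists rho => // r z S rr.
have [Sx xmin] := primalP p z S; have [Xx Ax] := Sx.
have [u Au hu] := sl _ _ Ax rr.
have [|v Xv Av|y [mu [E mu0]]] := @slater_multipliers R m n l A h (xs r z) u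
    (gF (xs r z) z) h_diff h_convex Xx hu.
- by rewrite Au.
- apply: (augK_min_gradient (lexx 0) (@slice_convex r) (@slice_sub r) Sx xmin).
  by split; rewrite ?Av.
exists (col_mx y (\col_i mu i)); split.
  rewrite Qmx_trmx_mul col_mxKu addrA -[RHS]E; congr (_ + _).
  by apply: eq_bigr => i _; rewrite col_mxEd mxE.
by move=> i; rewrite col_mxEd mxE.
Qed.

(** The normal cone of X, in the form in which the projection delivers its elements. *)
Lemma subdifferential_indicatorP (x s : 'cV[R]_n) : X x ->
  subdifferential (indicator X) x s <-> forall v, X v -> dotv s (v - x) <= 0.
Proof.
move=> Xx; rewrite /subdifferential /indicator /=; split.
  move=> H v Xv; have := H v; rewrite !mem_set//.
  by rewrite add0e lee_fin.
move=> H v; rewrite (mem_set Xx) add0e; case: ifPn => [/set_mem Xv|_].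
  by rewrite lee_fin; exact: H.
by rewrite leey.
Qed.

Lemma multiplier_sign x v (lam : 'cV[R]_(m + l)) : X v ->
  (forall i, 0 <= lam (rshift m i) 0 /\ lam (rshift m i) 0 * h i x = 0) ->
  dotv (\sum_i lam (rshift m i) 0 *: grad (h i) x) (v - x) <= 0.
Proof.
move=> Xv M; rewrite dotv_suml; apply: sumr_le0 => i _; rewrite dotvZl.
have [l0 lh] := M i.
have := ler_wpM2l l0 (convex_grad_le v (h_diff i x) (h_convex i)).
by rewrite mulrBr lh subr0 => /le_trans; apply; apply: mulr_ge0_le0.
Qed.

(** At a fixed point the proximal gradient p (x - z) vanishes, so multipliers of the proximal
    problem serve the original one. This makes the constant rank condition available there. *)
Lemma primal_fixed_stationary z : xs 0 z = z -> stationary_set A b f h z.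
Proof.
move=> zE; have [Sz zmin] := primalP p z slice0_nonempty; rewrite zE in Sz zmin.
have [Xz Az] := Sz; rewrite addr0 in Az.
have [rho rho0 mul] := primal_multiplier.
have [|lam [E lam0]] := mul 0 z slice0_nonempty; first by rewrite enorm0 ltW.
rewrite zE gradK0E subrr scaler0 addr0 Qmx_trmx_mul addrA in E lam0.
split=> //; exists (usubmx lam), 0; split; last 2 first.
- by rewrite enorm0.
- by rewrite Az subrr enorm0.
exists (\sum_i lam (rshift m i) 0 *: grad (h i) z); last by rewrite E.
apply/subdifferential_indicatorP => // v Xv.
exact: multiplier_sign Xv lam0.
Qed.

(** * Constant rank and the linear error bound *)

Variable Lh : R.
Hypothesis h_lipschitz : forall i, lipschitz_grad (h i) Lh setT.
Hypothesis h_crcq : CRCQ A b f h.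

Lemma active_set_rshift x i : (rshift m i \in active_set m h x) = (h i x == 0).
Proof. by rewrite inE -[rshift m i]/(unsplit (inr i)) unsplitK. Qed.

Lemma active_set_lshift x j : lshift l j \in active_set m h x.
Proof. by rewrite inE -[lshift l j]/(unsplit (inl j)) unsplitK. Qed.

Lemma multiplier_active x g lam : multiplier A h x g lam ->
  csupp lam \subset active_set m h x.
Proof.
move=> [_ M]; apply/fintype.subsetP => k; case: (split_ordP k) => [j ->|i ->].
  by rewrite active_set_lshift.
rewrite active_set_rshift inE => li; have [_ /eqP] := M i.
by rewrite mulf_eq0 (negbTE li).
Qed.

Lemma active_set_near z : X z ->
  \forall x \near z, active_set m h x \subset active_set m h z.
Proof.
move=> Xz.
have H : \forall x \near z, forall i, h i z < 0 -> h i x < 0.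
  apply: (@filter_forall _ _ (fun i x => h i z < 0 -> h i x < 0) (nbhs z)) => i.
  have [hz|hz] := boolP (h i z < 0); last by apply: (@filterE _ (nbhs z)).
  have ci := differentiable_continuous (h_diff i z).
  have hn : \forall x \near z, h i x < 0.
    exact: (@cvgr_lt R _ (nbhs z) _ (h i) (h i z) ci 0 hz).
  by apply: filterS hn => x.
apply: filterS H => x H; apply/fintype.subsetP => k.
case: (split_ordP k) => [j ->|i ->]; rewrite ?active_set_lshift//.
rewrite !active_set_rshift => /eqP hx; apply: contraT => hz.
have := H i; rewrite hx ltxx lt_neqAle hz => H'.
by have := H' (Xz i).
Qed.

Lemma crcq_rank_near z (S : {set 'I_(m + l)}) : stationary_set A b f h z ->
  S \subset active_set m h z ->
  \forall x \near z, \rank (Qsub A h S x) = \rank (Qsub A h S z).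
Proof.
(* [CRCQ] speaks of nonempty sets; for the empty one the matrices have no rows. *)
move=> zs Sz; have [S0|S0] := eqVneq S finset.set0.
  apply: (@filterE _ (nbhs z)) => x; move: (Qsub A h S x) (Qsub A h S z).
  by rewrite S0 cards0 => M N; rewrite [M]flatmx0 [N]flatmx0.
have [r Hr] := h_crcq zs S0 Sz.
have rz : \rank (Qsub A h S z) = r := nbhs_singleton Hr.
by apply: filterS Hr => x ->.
Qed.

Lemma monotone_gradK0 x x' z : X x -> X x' ->
  (p - Lf) * enorm (x - x') ^+ 2 <= dotv (gF x z - gF x' z) (x - x').
Proof.
move=> Xx Xx'.
have := augK_lower p z 0 (lexx 0) Xx Xx'; have := augK_lower p z 0 (lexx 0) Xx' Xx.
rewrite -(opprB x x') enormN dotvNr dotvDl dotvNl; lra.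
Qed.

Lemma gradK0_lipschitz x x' z : X x -> X x' ->
  enorm (gF x z - gF x' z) <= (Lf + p) * enorm (x - x').
Proof.
move=> Xx Xx'; rewrite !gradK0E.
have -> : grad f x + p *: (x - z) - (grad f x' + p *: (x' - z)) =
    (grad f x - grad f x') + p *: (x - x').
  by rewrite opprD addrACA -scalerBr opprB addrA subrK.
apply: le_trans (enormD _ _) _; rewrite enormZ gtr0_norm// mulrDl.
by rewrite lerD2r f_lipschitz.
Qed.

Lemma enorm_usubmx_le (w : 'cV[R]_(m + l)) : enorm (usubmx w) <= enorm w.
Proof.
rewrite enorm_sqr_le [leRHS]/dotv big_split_ord /= -[leLHS]addr0; apply: lerD.
  by apply: ler_sum => i _; rewrite !mxE.
by apply: sumr_ge0 => i _; rewrite -expr2 sqr_ge0.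
Qed.

(** When the difference of the stationarity equations is paired with x - x', the inequality
    multipliers contribute with a favourable sign ([multiplier_sign]), which leaves the equality
    multipliers against A (x - x'). *)
Lemma multiplier_monotone x x' z lam lam' : X x -> X x' ->
  multiplier A h x (gF x z) lam -> multiplier A h x' (gF x' z) lam' ->
  (p - Lf) * enorm (x - x') ^+ 2 <=
  enorm (lam - lam') * enorm (A *m (x - x')).
Proof.
move=> Xx Xx' [E M] [E' M'].
apply: le_trans (monotone_gradK0 z Xx Xx') _.
have := multiplier_sign Xx' M; have := multiplier_sign Xx M'.
move: E E'; rewrite !Qmx_trmx_mul.
move: (\sum_i lam _ _ *: _) (\sum_i lam' _ _ *: _) (gF x z) (gF x' z) => s s' g g'.
move=> /eqP; rewrite addr_eq0 => /eqP -> /eqP; rewrite addr_eq0 => /eqP ->.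
have : dotv (usubmx lam' - usubmx lam) (A *m (x - x')) <=
    enorm (lam - lam') * enorm (A *m (x - x')).
  apply: le_trans (dotv_le _ _) _; rewrite ler_wpM2r ?enorm_ge0//.
  by rewrite -linearB /= (enormBC lam) enorm_usubmx_le.
rewrite -(opprB x x') dotvNr; move: (x - x') => d.
rewrite !(dotvDl, dotvNl) !dotv_trmxl; lra.
Qed.

(** Subtracting the equations gives Q (lam - lam') = (g' - g) - (Q - Q') lam', where the size of
    lam' is controlled by its own equation. *)
Lemma dual_difference_bound k (Q Q' : 'M[R]_(n, k)) g g' lam lam' e L LQ G d :
  0 < e -> 0 <= LQ -> 0 <= d -> g + Q *m lam = 0 -> g' + Q' *m lam' = 0 ->
  e * enorm (lam - lam') <= enorm (Q *m (lam - lam')) ->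
  e * enorm lam' <= enorm (Q' *m lam') ->
  enorm (Q *m lam' - Q' *m lam') <= LQ * d * enorm lam' ->
  enorm (g - g') <= L * d -> enorm g' <= G ->
  enorm (lam - lam') <= (L + LQ * (G / e)) / e * d.
Proof.
move=> e0 LQ0 d0 /eqP; rewrite addr_eq0 => /eqP -> /eqP; rewrite addr_eq0 => /eqP ->.
rewrite enormN => low low' QL gL gG.
have lam'G : enorm lam' <= G / e by rewrite ler_pdivlMr// mulrC (le_trans low').
have h1 : LQ * d * enorm lam' <= LQ * d * (G / e) by rewrite ler_wpM2l// mulr_ge0.
have h2 := enormB (Q *m lam - Q' *m lam') (Q *m lam' - Q' *m lam').
have h3 : Q *m (lam - lam') = Q *m lam - Q' *m lam' - (Q *m lam' - Q' *m lam').
  by rewrite opprB addrA subrK mulmxBr.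
rewrite mulrAC ler_pdivlMr// mulrC (le_trans low)// h3 (le_trans h2)// mulrDl.
apply: lerD.
  by rewrite -enormN opprD.
by rewrite (le_trans QL)// (le_trans h1)// mulrAC.
Qed.

Lemma local_error_bound zb : X zb -> xs 0 zb = zb -> exists2 de, 0 < de &
  exists2 ze, 0 < ze & forall z r, X z -> enorm (z - zb) <= de -> enorm r <= de ->
  slice r !=set0 -> enorm (xs r z - xs 0 z) <= ze * enorm r.
Proof.
move=> Xzb zbE; have zbs := primal_fixed_stationary zbE.
have mu0 : 0 < p - Lf by rewrite subr_gt0.
have /near_enormP[e1 e10 H1] := active_set_near Xzb.
have /near_enormP[e2 e20 H2] : \forall x \near zb,
    forall S : {set 'I_(m + l)}, S \subset active_set m h zb ->
    \rank (Qsub A h S x) = \rank (Qsub A h S zb).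
  have Hn (S : {set 'I_(m + l)}) : \forall x \near zb, S \subset active_set m h zb ->
      \rank (Qsub A h S x) = \rank (Qsub A h S zb).
    have [Sz|Sz] := boolP (S \subset active_set m h zb).
      by apply: filterS (crcq_rank_near zbs Sz) => x.
    by apply: (@filterE _ (nbhs zb)) => x /notF [].
  exact: (@filter_forall _ _ _ _ (nbhs_filter zb) Hn).
(* One e for all supports: there are finitely many, and each admits every small e. *)
have [e3 e30 H3] : exists2 e, 0 < e & forall S : {set 'I_(m + l)},
    row_free (Qsub A h S zb) -> forall x, enorm (x - zb) <= e ->
    forall lam, csupp lam \subset S -> e * enorm lam <= enorm ((Qmx A h x)^T *m lam).
  have Hn : \forall e \near 0^'+, forall S : {set 'I_(m + l)},
      row_free (Qsub A h S zb) -> forall x, enorm (x - zb) <= e ->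
      forall lam, csupp lam \subset S -> e * enorm lam <= enorm ((Qmx A h x)^T *m lam).
    apply: filter_forall => S.
    have [/(row_free_lower_bound h_lipschitz)[e0 e00 He]|Sn] :=
        boolP (row_free (Qsub A h S zb)).
      by near=> e => _; apply: He; [|near: e; exact: nbhs_right_le].
    by near=> e.
  near (0 : R)^'+ => e; exists e => //; near: e; exact: Hn.
pose e0 := Num.min e1 (Num.min e2 e3).
have e00 : 0 < e0 by rewrite !lt_min e10 e20.
have [rho1 [C [rho10 C0 hol]]] := primal_holder.
have [rho2 rho20 mul] := primal_multiplier.
have [G G0 HG] := gradK0_bounded.
pose LQ := l%:R * `|Lh|; have LQ0 : 0 <= LQ by rewrite mulr_ge0.
pose C1 := ((Lf + p) + LQ * (G / e3)) / e3.
have C10 : 0 < C1.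
  have : 0 <= LQ * (G / e3) by rewrite mulr_ge0// divr_ge0 ?ltW.
  move=> H; apply: divr_gt0 => //; apply: ltr_pwDl => //; exact: ltr_wpDl.
(* The first two bounds give the square-root estimate and the multipliers along the path. The last
   two keep the path within e0/4 of x*(z), and x*(z) within e0/4 of zb, hence inside all three
   neighbourhoods. *)
pose de := Num.min (Num.min rho1 rho2) (Num.min ((e0 / 4) ^+ 2 / C) (e0 / 4 / (p / (p - Lf)))).
have q0 : 0 < p / (p - Lf) by rewrite divr_gt0.
exists de.
  by rewrite !lt_min rho10 rho20 ?divr_gt0 ?exprn_gt0 ?divr_gt0.
exists (C1 / (p - Lf)); first by rewrite divr_gt0.
move=> z r Xz; rewrite !le_min => /andP[_ /andP[_ zde]] /andP[/andP[r1 r2] /andP[r3 _]] S.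
have Ss s : 0 <= s <= 1 -> slice (s *: r) !=set0.
  move=> /andP[s0 s1]; have [x [Xx Ax]] := S; have [x' [Xx' Ax']] := slice0_nonempty.
  exists (x' + s *: (x - x')); split; first exact: convex_setP.
  by rewrite mulmxDr -scalemxAr mulmxBr Ax Ax' addr0 [b + r]addrC addrK.
have nrs s : 0 <= s <= 1 -> enorm (s *: r) <= enorm r.
  by move=> /andP[s0 s1]; rewrite enormZ ger0_norm// ler_piMl ?enorm_ge0.
have hols s t : 0 <= s <= 1 -> 0 <= t <= 1 ->
    enorm (xs (s *: r) z - xs (t *: r) z) ^+ 2 <= C * enorm r * `|s - t|.
  move=> s01 t01.
  have := hol _ _ _ Xz (Ss _ s01) (Ss _ t01) (le_trans (nrs _ s01) r1) (le_trans (nrs _ t01) r1).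
  by rewrite -scalerBl enormZ (mulrC `|_|) mulrA.
have xnear s : 0 <= s <= 1 -> enorm (xs (s *: r) z - zb) < e0.
  move=> s01; apply: le_lt_trans (enorm_triangle (xs 0 z) _ _) _.
  have h1 : enorm (xs (s *: r) z - xs 0 z) <= e0 / 4.
    rewrite -(@ler_pXn2r _ 2) ?nnegrE ?enorm_ge0 ?divr_ge0 ?(ltW e00)//.
    have := hols s 0 s01; rewrite lexx ler01 scale0r => /(_ isT) /le_trans; apply.
    move: r3; rewrite ler_pdivlMr// mulrC => /(le_trans _); apply.
    by move: s01 => /andP[s0 s1]; rewrite ler_piMr ?mulr_ge0 ?enorm_ge0 ?(ltW C0)// subr0 ger0_norm.
  have h2 : enorm (xs 0 z - zb) <= e0 / 4.
    rewrite -[X in _ - X]zbE (le_trans (primal_lipschitz _ _))//.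
    by rewrite mulrC -ler_pdivlMr.
  lra.
(* Independence is required at zb rather than at the path point, so that [H3] gives one lower bound
   for all parameters of a class. *)
pose E (T : {set 'I_(m + l)}) s := T \subset active_set m h zb /\
  row_free (Qsub A h T zb) /\ exists2 lam, csupp lam \subset T &
  multiplier A h (xs (s *: r) z) (gF (xs (s *: r) z) z) lam.
have -> : xs r z = xs (1 *: r) z by rewrite scale1r.
have -> : xs 0 z = xs (0 *: r) z by rewrite scale0r.
have [r0|r0] := eqVneq (enorm r) 0.
  by rewrite (enorm_eq0 r0) !scaler0 subrr !enorm0 mulr0.
have {}r0 : 0 < enorm r by rewrite lt_def r0 enorm_ge0.
apply: (@piecewise_lipschitz _ _ _ E (fun s => xs (s *: r) z) _ (C * enorm r)) => //.
- by apply: mulr_ge0; [apply: divr_ge0; exact: ltW|exact: enorm_ge0].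
- by rewrite mulr_gt0.
- move=> s s0 s1; have s01 : 0 <= s <= 1 by rewrite s0.
  have [lam /basic_multiplier[lam' M' free]] := mul _ z (Ss _ s01) (le_trans (nrs _ s01) r2).
  have := xnear s s01; rewrite !lt_min => /andP[x1 /andP[x2 x3]].
  have act : csupp lam' \subset active_set m h zb.
    by rewrite (fintype.subset_trans (multiplier_active M'))// H1.
  exists (csupp lam'); split; first exact: act.
  split; last by exists lam'; [exact: fintype.subxx|exact: M'].
  by rewrite /row_free -(H2 _ x2).
move=> T s t s01 t01 [Tact [Tfree [lam lamT M]]] [_ [_ [lam' lam'T M']]].
have [[Xs As] _] := primalP p z (Ss _ s01); have [[Xt At] _] := primalP p z (Ss _ t01).
have xs3 := xnear s s01; have xt3 := xnear t t01.
move: xs3 xt3; rewrite !lt_min => /andP[_ /andP[_ /ltW xs3]] /andP[_ /andP[_ /ltW xt3]].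
have key := multiplier_monotone Xs Xt M M'.
have ne := H3 _ Tfree _ xs3 (lam - lam').
have ne' := H3 _ Tfree _ xt3 lam' lam'T.
have lip := Qmx_trmx_lipschitz A h_lipschitz (xs (s *: r) z) (xs (t *: r) z) lam'.
have glip := gradK0_lipschitz z Xs Xt.
have gle := HG _ _ Xt Xz.
have {}ne : e3 * enorm (lam - lam') <=
    enorm ((Qmx A h (xs (s *: r) z))^T *m (lam - lam')).
  apply: ne; apply/fintype.subsetP => k; rewrite inE; apply: contraNT => kT.
  have := contra (fintype.subsetP lamT k) kT; have := contra (fintype.subsetP lam'T k) kT.
  by rewrite !inE !mxE !negbK => /eqP -> /eqP ->; rewrite subrr.
have C1P := dual_difference_bound e30 LQ0 (enorm_ge0 _) (proj1 M) (proj1 M') ne ne' lip glip gle.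
have Axx : A *m (xs (s *: r) z - xs (t *: r) z) = (s - t) *: r.
  by rewrite mulmxBr As At opprD addrACA subrr add0r scalerBl.
(* Monotonicity reads (p - Lf) dx^2 <= |lam - lam'| |s - t| |r|; with |lam - lam'| <= C1 dx one
   factor dx cancels. *)
rewrite Axx enormZ in key.
move: C1P key; rewrite -/C1; move: (enorm (lam - lam')) => la.
move: (enorm_ge0 (xs (s *: r) z - xs (t *: r) z)).
move: (enorm (xs (s *: r) z - xs (t *: r) z)) => dx dx0 C1P key.
have [dx00|dxn0] := eqVneq dx 0.
  rewrite dx00; apply: mulr_ge0 => //; apply: mulr_ge0; last exact: ltW.
  by apply: divr_ge0; exact: ltW.
have {}dx0 : 0 < dx by rewrite lt_def dxn0.
have h1 : la * (`|s - t| * enorm r) <= C1 * dx * (`|s - t| * enorm r).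
  by rewrite ler_wpM2r// mulr_ge0 ?enorm_ge0.
rewrite -mulrA mulrAC ler_pdivlMr// -(ler_pM2r dx0); lra.
Unshelve. all: by end_near.
Qed.

(** By compactness it suffices to work near each zb. Near a fixed point of x* the local bound
    applies; near any other point |z - x*(z)| is bounded away from 0 and the hypothesis fails for
    small e. In [P], e is both the radius and the inverse of the constant, so the claim concerns a
    single limit e -> 0+. *)
Lemma error_bound : exists2 de, 0 < de & exists2 ze, 0 < ze &
  forall z r, X z -> slice r !=set0 -> enorm r <= de -> enorm (z - xs 0 z) <= de ->
  enorm (xs r z - xs 0 z) <= ze * enorm r.
Proof.
pose P (e : R) z := forall r, X z -> slice r !=set0 -> enorm r <= e ->
  enorm (z - xs 0 z) <= e -> enorm (xs r z - xs 0 z) <= e^-1 * enorm r.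
suff : \forall e \near (0 : R)^'+, X `<=` P e.
  move=> H; near (0 : R)^'+ => e; exists e => //; exists e^-1; first by rewrite invr_gt0.
  have XP : X `<=` P e by near: e; exact: H.
  by move=> z r Xz S re ze; exact: (XP z Xz r).
have /compact_near_coveringP cov := Xcompact.
apply: cov => zb Xzb.
have [zbE|zbn] := eqVneq (xs 0 zb) zb.
  have [de de0 [ze ze0 H]] := local_error_bound Xzb zbE.
  have Hn : \forall z \near zb, enorm (z - zb) < de by apply/near_enormP; exists de.
  near=> z e => r Xz S re _.
  have zde : enorm (z - zb) <= de by apply: ltW; near: z.
  have egt0 : 0 < e by near: e; exact: nbhs_right_gt.
  have eze : e <= ze^-1 by near: e; apply: nbhs_right_le; rewrite invr_gt0.
  have ede : e <= de by near: e; exact: nbhs_right_le.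
  apply: le_trans (H z r Xz zde (le_trans re ede) S) _.
  rewrite ler_wpM2r ?enorm_ge0// -[leLHS]invrK lef_pV2 ?posrE ?invr_gt0//.
pose g := enorm (zb - xs 0 zb).
have g0 : 0 < g.
  rewrite lt_def enorm_ge0 andbT; apply: contra zbn => /eqP/enorm_eq0 /subr0_eq e.
  by rewrite -e.
pose q := p / (p - Lf); have q0 : 0 < q by rewrite divr_gt0// subr_gt0.
have d0 : 0 < g / 2 / (1 + q) by rewrite !divr_gt0//; lra.
have Hn : \forall z \near zb, enorm (z - zb) < g / 2 / (1 + q).
  by apply/near_enormP; exists (g / 2 / (1 + q)).
near=> z e => r Xz _ _ ze; exfalso.
have egt : e < g / 2 by near: e; apply: nbhs_right_lt; rewrite divr_gt0.
have : enorm (z - zb) < g / 2 / (1 + q) by near: z.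
rewrite ltr_pdivlMr; last by lra.
move=> /ltrD/(_ egt); rewrite -splitr ltNge => /negP; apply.
exact: enorm_displacement (primal_lipschitz z zb) ze.
Unshelve. all: by end_near.
Qed.

(** * Descent of the potential and convergence *)

Variables gamma c alpha : R.
Hypothesis gamma_ge0 : 0 <= gamma.
Hypothesis c_gt0 : 0 < c.
Hypothesis c_lt : c * (Lf + gamma * sigma_max A ^+ 2 + p) < 1.
Hypothesis alpha_gt0 : 0 < alpha.
Hypothesis alpha_lt : 4 * alpha * sigma_max A ^+ 2 < c * (p - Lf) ^+ 2.

Definition dualval y z := K gamma p (dualx gamma p y z) z y.
Definition primalval z := F (xs 0 z) z.
Definition potential x y z := K gamma p x z y - 2 * dualval y z + 2 * primalval z.

Lemma augK_prox_sub g u z z' y : K g p u z' y - K g p u z y =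
  p / 2 * (enorm (u - z') ^+ 2 - enorm (u - z) ^+ 2).
Proof. by rewrite /augK; ring. Qed.

Lemma augK_dual_sub u z y y' : K gamma p u z y' - K gamma p u z y =
  dotv (y' - y) (A *m u - b).
Proof. by rewrite /augK dotvDl dotvNl; ring. Qed.

Lemma prox_shift (u z w : 'cV[R]_n) beta :
  enorm (u - (z + beta *: w)) ^+ 2 - enorm (u - z) ^+ 2 =
  beta ^+ 2 * enorm w ^+ 2 - 2 * beta * dotv (u - z) w.
Proof.
rewrite opprD addrA; move: (u - z) => a.
by rewrite !enorm_sqr !dotvE (dotvC w a); ring.
Qed.

Lemma modulus_gt0 : 0 < p - Lf. Proof. by rewrite subr_gt0. Qed.

Lemma step_modulus : c * (p - Lf) <= 1.
Proof.
have h1 : 0 <= gamma * sigma_max A ^+ 2 by rewrite mulr_ge0 ?sqr_ge0.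
apply: le_trans (ltW c_lt); rewrite ler_pM2l//.
by move: h1 Lf_ge0; move: (gamma * _) => g; lra.
Qed.

(** Net coefficient of |x^{t+1} - x^t|^2: the gain 1/(2c) of the primal step less the loss in
    [step_ascent]. The bound on alpha says exactly that it is positive. *)
Definition residual_weight : R :=
  1 / (2 * c) - 2 * alpha * sigma_max A ^+ 2 / (c * (p - Lf)) ^+ 2.

Lemma residual_weight_gt0 : 0 < residual_weight.
Proof.
have mu0 := modulus_gt0.
rewrite /residual_weight subr_gt0 ltr_pdivrMr ?exprn_gt0 ?mulr_gt0//.
have -> : 1 / (2 * c) * (c * (p - Lf)) ^+ 2 = c * (p - Lf) ^+ 2 / 2.
  by field; rewrite gt_eqF.
move: alpha_lt; move: (sigma_max A ^+ 2) (c * _) => s t; lra.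
Qed.

(** * Estimates for one iteration *)

Section Step.
Variables (x z xp zp : 'cV[R]_n) (y yp : 'cV[R]_m) (beta : R).
Hypotheses (Xx : X x) (Xz : X z) (Xxp : X xp).
Hypothesis xp_VI : forall v, X v ->
  dotv (x - c *: gradK gamma p x z yp - xp) (v - xp) <= 0.
Hypothesis yp_eq : yp = y + alpha *: (A *m x - b).
Hypothesis zp_eq : zp = z + beta *: (xp - z).
Hypotheses (beta_gt0 : 0 < beta) (beta_le1 : beta <= 1).
Local Notation x1 := (dualx gamma p yp z).
Local Notation r1 := (A *m x1 - b).

Lemma step_in_feasX : X zp.
Proof. by rewrite zp_eq; apply: convex_setP => //; exact: ltW. Qed.

(** The projection inequality at v = x gives <g, xp - x> <= -|xp - x|^2 / c, and c times the upper
    curvature of K is below 1. *)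
Lemma step_decrease :
  K gamma p xp z yp + enorm (xp - x) ^+ 2 / (2 * c) <= K gamma p x z yp.
Proof.
have := xp_VI Xx; have := augK_upper p z yp gamma_ge0 Xx Xxp.
have := sqr_ge0 (enorm (xp - x)); have := c_lt.
move: (gradK _ _ _ _ _) (Lf + _ + p) (K _ _ xp _ _) (K _ _ x _ _) => g L k' k.
have -> : x - c *: g - xp = - (xp - x + c *: g) by rewrite opprD opprB addrAC.
rewrite -(opprB xp x) dotvNl dotvNr opprK; move: (xp - x) => s.
rewrite dotvDl dotvZl -enorm_sqr; move: (enorm s ^+ 2) (dotv g s) => e d.
move=> cL e0 up vi.
have : c * k' <= c * (k + d + L / 2 * e) by rewrite ler_pM2l.
have : c * L * e <= 1 * e by rewrite ler_wpM2r// ltW.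
move=> h1 h2; rewrite -lerBrDl ler_pdivrMr ?mulr_gt0//; lra.
Qed.

(* From [m a^2 - (m+1) a s + (m+1)/2 s^2 <= 0] with [m = c (p - Lf) <= 1]. *)
Lemma step_error :
  (c * (p - Lf)) ^+ 2 * enorm (x - x1) ^+ 2 <= 2 * enorm (xp - x) ^+ 2.
Proof.
have [Xx1 x1min] := dualxP gamma p yp z feasX_nonempty.
have := xp_VI Xx1; have := augK_upper p z yp gamma_ge0 Xx Xxp.
have := augK_lower p z yp gamma_ge0 Xx Xx1.
have := augK_min_growth gamma_ge0 Xconvex (@subset_refl _ X) Xx1 x1min Xxp.
have := sqr_ge0 (enorm (xp - x)); have := c_lt; have := step_modulus.
have := modulus_gt0.
move: (gradK _ _ _ _ _) (Lf + _ + p) (p - Lf) => g L mu.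
move: (K _ _ xp _ _) (K _ _ x _ _) (K _ _ x1 _ _) => k' k k1.
move: x1 => u.
have -> : x - c *: g - xp = - (xp - x + c *: g) by rewrite opprD opprB addrAC.
rewrite (enormBC u x).
have -> : u - x = - (x - u) by rewrite opprB.
have -> : u - xp = - ((x - u) + (xp - x)) by rewrite [X in _ = - X]addrC subrKA opprB.
have -> : xp - u = (x - u) + (xp - x) by rewrite [RHS]addrC subrKA.
move: (x - u) (xp - x) => a s.
rewrite !dotvNl !dotvNr opprK.
rewrite (enorm_sqr (a + s)) !dotvE (dotvC a s) -!enorm_sqr.
have := dotv_ge s a; have := enorm_ge0 s; have := enorm_ge0 a.
move: (enorm a) (enorm s) (dotv s a) (dotv g a) (dotv g s) => ea es d ga gs.
move=> ea0 es0 d_ge mu0 mu1 cL es2 growth low up vi.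
have h1 : c * L * es ^+ 2 <= 1 * es ^+ 2 by rewrite ler_wpM2r// ltW.
have h2 : c * (k1 + mu / 2 * (ea ^+ 2 + d + (d + es ^+ 2)) + mu / 2 * ea ^+ 2)
    <= c * (k1 + (ga + gs) + L / 2 * es ^+ 2).
  by rewrite ler_pM2l//; lra.
have h3 : c * mu * ea ^+ 2 + (c * mu + 1) * d + (c * mu + 1) / 2 * es ^+ 2 <= 0.
  by move: h1 h2 vi; lra.
move: (c * mu) mu1 (mulr_gt0 c_gt0 mu0) h3 => M M1 M0 h3.
have h4 : (M + 1) * - (es * ea) <= (M + 1) * d by rewrite ler_wpM2l//; lra.
(* The factor 2 M prepares the square of M ea - (M + 1) es; what remains is M^2 ea^2 <= (M + 1) es^2
   <= 2 es^2. *)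
have h5 : (2 * M) * (M * ea ^+ 2 - (M + 1) * (es * ea) + (M + 1) / 2 * es ^+ 2) <= 0.
  by apply: mulr_ge0_le0; lra.
have h6 : M * es ^+ 2 <= 1 * es ^+ 2 by rewrite ler_wpM2r.
have := sqr_ge0 (M * ea - (M + 1) * es); move: h5 h6; lra.
Qed.

(** Polarization: 2 <ra, rb> - |ra|^2 = |rb|^2 - |ra - rb|^2 for the two residuals, and ra - rb = A
    (x - x1) is controlled by [step_error]. *)
Lemma step_ascent :
  alpha * enorm (A *m x1 - b) ^+ 2
    - 2 * alpha * sigma_max A ^+ 2 / (c * (p - Lf)) ^+ 2 * enorm (xp - x) ^+ 2
    <= 2 * (alpha * dotv (A *m x - b) (A *m x1 - b)) - alpha * enorm (A *m x - b) ^+ 2.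
Proof.
have g1 : enorm (A *m x - b - (A *m x1 - b)) ^+ 2 <= sigma_max A ^+ 2 * enorm (x - x1) ^+ 2.
  rewrite opprB addrA subrK -mulmxBr -exprMn.
  rewrite ler_pXn2r ?nnegrE ?mulr_ge0 ?enorm_ge0 ?sigma_max_ge0//.
  exact: sigma_max_le.
have m0 : 0 < (c * (p - Lf)) ^+ 2 by rewrite exprn_gt0// mulr_gt0// modulus_gt0.
have g2 : sigma_max A ^+ 2 * enorm (x - x1) ^+ 2 <=
    sigma_max A ^+ 2 * (2 * enorm (xp - x) ^+ 2 / (c * (p - Lf)) ^+ 2).
  by rewrite ler_wpM2l ?sqr_ge0// ler_pdivlMr// mulrC step_error.
have g3 := le_trans g1 g2; rewrite -(ler_pM2l alpha_gt0) in g3.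
move: g3; move: (A *m x - b) (A *m x1 - b) => ra rb.
rewrite !enorm_sqr !dotvE (dotvC rb ra); lra.
Qed.

(** Three comparisons of minimizers: x(yp, z) is tested in d(y, z), x(yp, zp) in d(yp, z), and x*(z)
    in P(zp). Moving z by beta w then produces the cross term 2 p beta <x(yp, zp) - x*(z), w>, the
    source of the error. *)
Lemma potential_step : 16 * (p / (p - Lf)) * beta <= 1 ->
  potential xp yp zp +
    (residual_weight * enorm (xp - x) ^+ 2 + alpha * enorm r1 ^+ 2
     + p * beta / 4 * enorm (xp - z) ^+ 2)
  <= potential x y z + 8 * p * beta * enorm (xs 0 z - x1) ^+ 2.
Proof.
move=> beta_small.
have [Xx1 x1min] := dualxP gamma p yp z feasX_nonempty.
have [Xx2 x2min] := dualxP gamma p yp zp feasX_nonempty.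
have [_ x0min] := dualxP gamma p y z feasX_nonempty.
have [Sx xmin] := primalP p z slice0_nonempty.
have [Sx2 x2min'] := primalP p zp slice0_nonempty.
pose q := p / (p - Lf); pose w := xp - z.
set u1 := x1 in Xx1 x1min *; set u2 := dualx gamma p yp zp in Xx2 x2min.
have lip : enorm (u1 - u2) <= q * (beta * enorm w).
  have := augK_min_lipschitz gamma_ge0 (ltW p_gt0) Lf_lt Xconvex (@subset_refl _ X)
    Xx1 Xx2 x1min x2min.
  by rewrite zp_eq opprD addrA subrr add0r enormN enormZ gtr0_norm.
have e1 : K gamma p x z yp = K gamma p x z y + alpha * enorm (A *m x - b) ^+ 2.
  have := augK_dual_sub x z y yp; rewrite yp_eq [y + _]addrC addrK dotvZl -enorm_sqr.
  by move/eqP; rewrite subr_eq => /eqP ->; rewrite addrC.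
have e2 := step_decrease.
have e3 := augK_prox_sub gamma xp z zp yp; rewrite [in RHS]zp_eq prox_shift -/w -enorm_sqr in e3.
have e4 := x0min _ Xx1.
have e5 := augK_dual_sub u1 z y yp.
rewrite {2}yp_eq [y + _]addrC addrK dotvZl in e5.
have e6 := x1min _ Xx2.
have e7 := augK_prox_sub gamma u2 z zp yp; rewrite [in RHS]zp_eq prox_shift -/w in e7.
have e8 := x2min' _ Sx.
have e9 := augK_prox_sub 0 (xs 0 z) z zp 0; rewrite [in RHS]zp_eq prox_shift -/w in e9.
have f1 : - ((enorm (xs 0 z - u1) + q * (beta * enorm w)) * enorm w) <=
    dotv (xs 0 z - z) w - dotv (u2 - z) w.
  rewrite -dotvNl -dotvDl opprB subrKA.
  apply: le_trans (dotv_ge _ _); rewrite lerN2 ler_wpM2r ?enorm_ge0//.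
  by rewrite (le_trans (enorm_triangle u1 _ _))// lerD2l.
have f2 := step_ascent; rewrite -/u1 in f2.
move: e1 e2 e3 e4 e5 e6 e7 e8 e9 f1 f2; rewrite /potential /residual_weight.
rewrite /dualval -/u2 /primalval -/w.
move: (dotv (xs 0 z - z) w) (dotv (u2 - z) w) => i1 i2.
move: (dotv (A *m x - b) _) (enorm (A *m x - b)) (enorm (A *m u1 - b)) => i3 i4 i5.
have := enorm_ge0 w; have := enorm_ge0 (xs 0 z - u1).
move: (enorm (xs 0 z - u1)) (enorm w) (enorm (xp - x)) => W nw s W0 nw0.
move: (K _ _ (dualx gamma p y z) _ _) (K _ _ u1 z yp) (K _ _ u1 z y) => k1 k2 k3.
move: (K _ _ u2 z yp) (K _ _ u2 zp yp) (K _ _ x z y) (K _ _ x z yp) => k4 k5 k6 k7.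
move: (K _ _ xp z yp) (K _ _ xp zp yp) (F (xs 0 zp) zp) => k8 k9 k10.
move: (F (xs 0 z) z) (F (xs 0 z) zp) => k11 k12.
move=> e1 e2 e3 e4 e5 e6 e7 e8 e9 f1 f2.
have pb : 0 < p * beta by rewrite mulr_gt0.
have f3 : - (p * beta * ((W + q * (beta * nw)) * nw)) <= p * beta * (i1 - i2).
  by rewrite -mulrN ler_pM2l.
have f4 : 16 * q * beta * (p * beta * nw ^+ 2) <= 1 * (p * beta * nw ^+ 2).
  by rewrite ler_wpM2r// mulr_ge0 ?sqr_ge0// ltW.
(* Young's inequality 2 W nw <= 8 W^2 + nw^2 / 8. It and [f4] each take an eighth of the half left
   by beta <= 1, which leaves the quarter in the statement. *)
have f5 : 0 <= p * beta * (8 * W - nw) ^+ 2 by rewrite mulr_ge0 ?sqr_ge0// ltW.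
have f6 : beta * (p * beta * nw ^+ 2) <= 1 * (p * beta * nw ^+ 2).
  by rewrite ler_wpM2r// mulr_ge0 ?sqr_ge0// ltW.
lra.
Qed.

Lemma step_distance : enorm (x - x1) <= 2 / (c * (p - Lf)) * enorm (xp - x).
Proof.
have m0 : 0 < c * (p - Lf) by rewrite mulr_gt0// modulus_gt0.
rewrite mulrAC ler_pdivlMr// mulrC.
rewrite -(@ler_pXn2r _ 2) ?nnegrE ?mulr_ge0 ?enorm_ge0 ?(ltW c_gt0) ?(ltW modulus_gt0)//.
rewrite exprMn [leRHS]exprMn; apply: le_trans step_error _.
by rewrite ler_wpM2r ?sqr_ge0//; lra.
Qed.

Lemma step_feasibility : enorm (A *m xp - b) <= enorm r1
  + sigma_max A * (1 + 2 / (c * (p - Lf))) * enorm (xp - x).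
Proof.
have -> : A *m xp - b = r1 + A *m (xp - x + (x - x1)).
  by rewrite subrKA mulmxBr [RHS]addrC subrKA.
apply: le_trans (enormD _ _) _; rewrite lerD2l.
apply: le_trans (sigma_max_le _ _) _; rewrite -mulrA ler_wpM2l ?sigma_max_ge0//.
apply: le_trans (enormD _ _) _; rewrite mulrDl mul1r lerD2l; exact: step_distance.
Qed.

Lemma step_normal v : X v ->
  0 <= dotv (gradK gamma p x z yp + c^-1 *: (xp - x)) (v - xp).
Proof.
move=> Xv; have := xp_VI Xv; move: (gradK gamma p x z yp) => g.
have -> : x - c *: g - xp = - (c *: (g + c^-1 *: (xp - x))).
  by rewrite scalerDr scalerA mulfV ?gt_eqF// scale1r opprD opprB addrCA addrA.
by rewrite dotvNl dotvZl oppr_le0 pmulr_rge0.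
Qed.

(** One constant above the coefficients of both the gradient residual and the infeasibility. *)
Definition stationarity_const : R :=
  Lf + p + c^-1 + 1 + sigma_max A * (1 + 2 / (c * (p - Lf))).

Lemma stationarity_const_gt0 : 0 < stationarity_const.
Proof.
have s0 := sigma_max_ge0 A; have m0 : 0 < c * (p - Lf) by rewrite mulr_gt0// modulus_gt0.
rewrite /stationarity_const ltr_pwDl ?mulr_ge0 ?addr_ge0 ?divr_ge0 ?(ltW m0)//.
by rewrite ltr_wpDl// !addr_ge0 ?invr_ge0 ?(ltW p_gt0) ?(ltW c_gt0).
Qed.

Lemma step_stationary e :
  stationarity_const * (enorm (xp - x) + enorm r1 + enorm (xp - z)) <= e ->
  eps_stationary A b f h e xp.
Proof.
move=> le_e; split=> //.
pose s0 := - (gradK gamma p x z yp + c^-1 *: (xp - x)).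
(* The gradient of the penalty term at x is absorbed into the multiplier. *)
exists (yp + gamma *: (A *m x - b)).
exists (grad f xp - grad f x - (p *: (x - z) + c^-1 *: (xp - x))).
have ns := enorm_ge0 (xp - x); have nr := enorm_ge0 r1; have nw := enorm_ge0 (xp - z).
have sg := sigma_max_ge0 A; have m0 : 0 < c * (p - Lf) by rewrite mulr_gt0// modulus_gt0.
have ci : 0 < c^-1 by rewrite invr_gt0.
have k0 : 0 <= sigma_max A * (1 + 2 / (c * (p - Lf))).
  by rewrite mulr_ge0// addr_ge0// divr_ge0 ?ltW.
split.
- exists s0.
    apply/subdifferential_indicatorP => // v Xv.
    by rewrite /s0 dotvNl oppr_le0; exact: step_normal.
  rewrite /s0 /gradK; move: (A *m x - b) => r; rewrite mulmxDr -scalemxAr.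
  move: (grad f xp) (grad f x) (A^T *m yp) (gamma *: _) (p *: _) (c^-1 *: _).
  by move=> g' g a1 a2 a3 a4; apply/matrixP => i j; rewrite !mxE; ring.
- apply: le_trans le_e.
  have h1 : enorm (x - z) <= enorm (xp - x) + enorm (xp - z).
    by apply: le_trans (enorm_triangle xp _ _) _; rewrite (enormBC x).
  have h2 := f_lipschitz Xxp Xx.
  have h3 := enormB (grad f xp - grad f x) (p *: (x - z) + c^-1 *: (xp - x)).
  have h4 := enormD (p *: (x - z)) (c^-1 *: (xp - x)).
  rewrite !enormZ !gtr0_norm// in h4.
  apply: le_trans h3 _; apply: le_trans (lerD h2 h4) _.
  have h5 : p * enorm (x - z) <= p * (enorm (xp - x) + enorm (xp - z)).
    by rewrite ler_pM2l.
  rewrite /stationarity_const; move: k0 h5.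
  move: (sigma_max A * _) (enorm (x - z)) (enorm (xp - x)) ns (enorm (xp - z)) nw (enorm r1) nr.
  move=> k exz es es0 ew ew0 er er0 k0 h5.
  have := mulr_ge0 Lf_ge0 ew0; have := mulr_ge0 Lf_ge0 er0.
  have := mulr_ge0 (ltW p_gt0) er0; have := mulr_ge0 (ltW ci) er0.
  have := mulr_ge0 (ltW ci) ew0; have := mulr_ge0 k0 er0; have := mulr_ge0 k0 ew0.
  have := mulr_ge0 k0 es0; lra.
apply: le_trans le_e; apply: le_trans step_feasibility _.
rewrite /stationarity_const; move: k0.
move: (sigma_max A * _) (enorm (xp - x)) ns (enorm (xp - z)) nw (enorm r1) nr.
move=> k es es0 ew ew0 er er0 k0.
have := mulr_ge0 Lf_ge0 ew0; have := mulr_ge0 Lf_ge0 er0; have := mulr_ge0 Lf_ge0 es0.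
have := mulr_ge0 (ltW p_gt0) er0; have := mulr_ge0 (ltW p_gt0) ew0.
have := mulr_ge0 (ltW p_gt0) es0.
have := mulr_ge0 (ltW ci) er0; have := mulr_ge0 (ltW ci) ew0; have := mulr_ge0 (ltW ci) es0.
have := mulr_ge0 k0 er0; have := mulr_ge0 k0 ew0; lra.
Qed.

Definition limit_const : R := 1 + sigma_max A * (2 / (c * (p - Lf))).

Lemma limit_const_gt0 : 0 < limit_const.
Proof.
have m0 : 0 < c * (p - Lf) by rewrite mulr_gt0// modulus_gt0.
by rewrite ltr_pwDl// mulr_ge0 ?sigma_max_ge0// divr_ge0 ?ltW.
Qed.

Lemma step_residual_bound e : enorm (xp - x) <= e -> enorm r1 <= e ->
  enorm (A *m x - b) <= limit_const * e.
Proof.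
move=> se re; have sg := sigma_max_ge0 A.
have -> : A *m x - b = r1 + A *m (x - x1) by rewrite mulmxBr [RHS]addrC subrKA.
apply: le_trans (enormD _ _) _; rewrite mulrDl mul1r; apply: lerD => //.
apply: le_trans (sigma_max_le _ _) _; rewrite -mulrA ler_wpM2l//.
apply: le_trans step_distance _; rewrite ler_wpM2l//.
by rewrite divr_ge0// ltW// mulr_gt0// modulus_gt0.
Qed.

Lemma step_limit_feasible xb e : enorm (x - xb) <= e ->
  enorm (xp - x) <= e -> enorm r1 <= e ->
  enorm (A *m xb - b) <= (limit_const + sigma_max A) * e.
Proof.
move=> xe se re; have sg := sigma_max_ge0 A.
have -> : A *m xb - b = (A *m x - b) + A *m (xb - x).
  by rewrite mulmxBr [RHS]addrC subrKA.
apply: le_trans (enormD _ _) _; rewrite mulrDl; apply: lerD.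
  exact: step_residual_bound.
by apply: le_trans (sigma_max_le _ _) _; rewrite ler_wpM2l// enormBC.
Qed.

Definition limit_slope : R := Lf + sigma_max A * (1 + alpha * limit_const)
  + gamma * (sigma_max A * limit_const) + p * 2 + c^-1.

Lemma step_limit_gradient xb yb e : X xb -> enorm (x - xb) <= e ->
  enorm (y - yb) <= e -> enorm (xp - x) <= e -> enorm r1 <= e -> enorm (xp - z) <= e ->
  enorm (grad f xb + A^T *m yb - (gradK gamma p x z yp + c^-1 *: (xp - x)))
  <= limit_slope * e.
Proof.
move=> Xxb xe ye se re we.
have sg := sigma_max_ge0 A; have res := step_residual_bound se re.
have -> : grad f xb + A^T *m yb - (gradK gamma p x z yp + c^-1 *: (xp - x)) =
    (grad f xb - grad f x) + A^T *m (yb - yp)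
    + gamma *: (A^T *m - (A *m x - b)) + p *: (z - x) + c^-1 *: (x - xp).
  rewrite /gradK; move: (A *m x - b) => r; rewrite mulmxBr mulmxN.
  rewrite -(opprB x z) -(opprB xp x) !scalerN.
  move: (gamma *: _) (p *: _) (c^-1 *: _) (A^T *m yb) (A^T *m yp) => a1 a2 a3 a4 a5.
  move: (grad f xb) (grad f x) => g g'.
  by apply/matrixP => i j; rewrite !mxE; ring.
have h1 : enorm (grad f xb - grad f x) <= Lf * e.
  apply: le_trans (f_lipschitz Xxb Xx) _.
  by rewrite ler_wpM2l// enormBC.
have h2 : enorm (A^T *m (yb - yp)) <= sigma_max A * (1 + alpha * limit_const) * e.
  apply: le_trans (sigma_max_trmx_le _ _) _; rewrite -mulrA ler_wpM2l//.
  rewrite yp_eq opprD addrA; apply: le_trans (enormB _ _) _.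
  rewrite enormZ gtr0_norm// mulrDl mul1r; apply: lerD; first by rewrite enormBC.
  by rewrite -mulrA ler_pM2l.
have h3 : enorm (gamma *: (A^T *m - (A *m x - b))) <=
    gamma * (sigma_max A * limit_const) * e.
  rewrite enormZ ger0_norm// -mulrA ler_wpM2l//.
  apply: le_trans (sigma_max_trmx_le _ _) _; rewrite enormN -mulrA.
  by rewrite ler_wpM2l.
have h4 : enorm (p *: (z - x)) <= p * 2 * e.
  rewrite enormZ gtr0_norm// -mulrA ler_pM2l//.
  apply: le_trans (enorm_triangle xp _ _) _; rewrite (enormBC z) mulr_natl mulr2n.
  exact: lerD.
have h5 : enorm (c^-1 *: (x - xp)) <= c^-1 * e.
  by rewrite enormZ gtr0_norm ?invr_gt0// ler_pM2l ?invr_gt0// enormBC.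
rewrite /limit_slope !mulrDl.
do 4 (apply: le_trans (enormD _ _) _; apply: lerD => //).
Qed.

Lemma step_limit_VI xb yb v D e : X xb -> X v -> enorm (v - xp) <= D ->
  enorm (x - xb) <= e -> enorm (y - yb) <= e -> enorm (xp - x) <= e ->
  enorm r1 <= e -> enorm (xp - z) <= e ->
  - ((limit_slope * D + 2 * enorm (grad f xb + A^T *m yb)) * e) <=
  dotv (grad f xb + A^T *m yb) (v - xb).
Proof.
move=> Xxb Xv vD xe ye se re we.
have := step_limit_gradient Xxb xe ye se re we.
have := step_normal Xv.
move: (gradK gamma p x z yp + _) (grad f xb + _) => G wv nG le_G.
have -> : dotv wv (v - xb) = dotv G (v - xp) + dotv (wv - G) (v - xp) + dotv wv (xp - xb).
  by rewrite -dotvDl [G + _]addrC subrK -dotvDr subrKA.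
have h1 := dotv_ge (wv - G) (v - xp).
have h2 : enorm (wv - G) * enorm (v - xp) <= limit_slope * e * D.
  by apply: ler_pM; rewrite ?enorm_ge0.
have h3 := dotv_ge wv (xp - xb).
have h4 : enorm wv * enorm (xp - xb) <= enorm wv * (2 * e).
  rewrite ler_wpM2l ?enorm_ge0// (le_trans (enorm_triangle x _ _))//.
  by rewrite mulr_natl mulr2n lerD.
lra.
Qed.

End Step.

(** The multiplier yb is prescribed, so only mu is sought: [slater_multipliers] is applied to X
    alone, with an empty equality system. *)
Lemma limit_VI_KKT xb yb : X xb -> A *m xb = b ->
  (forall v, X v -> 0 <= dotv (grad f xb + A^T *m yb) (v - xb)) ->
  KKT_point A b f h xb yb.
Proof.
move=> Xxb Ab VI; have [u [_ hu]] := h_slater.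
have [||y0 [mu [E muP]]] := @slater_multipliers R 0 n l 0 h xb u
    (grad f xb + A^T *m yb) h_diff h_convex Xxb hu.
- by rewrite !mul0mx.
- by move=> v Xv _; exact: VI.
exists mu; split=> //; last by move=> i; have [] := muP i.
by move: E; rewrite trmx0 mul0mx addr0.
Qed.

(** The potential is (K - d) + (P - d) + P. Both differences are nonnegative: x and x*(z) are test
    points for d, and K reduces to the proximal objective where A x = b. *)
Lemma potential_ge flow x y z : (forall u, X u -> flow < f u) -> X x ->
  flow <= potential x y z.
Proof.
move=> fl Xx; have [Sx _] := primalP p z slice0_nonempty.
have [Xs As] := Sx; rewrite addr0 in As.
have [_ dmin] := dualxP gamma p y z feasX_nonempty.
have h1 := dmin _ Xx; have h2 := dmin _ Xs.
have h3 : K gamma p (xs 0 z) z y = primalval z.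
  by rewrite /primalval /augK As subrr enorm0 !dotv0r; ring.
have h4 : f (xs 0 z) <= primalval z.
  rewrite /primalval /augK As subrr enorm0 dotv0r.
  have : 0 <= p / 2 * enorm (xs 0 z - z) ^+ 2 by rewrite mulr_ge0 ?sqr_ge0// divr_ge0 ?ltW.
  by move: (p / 2 * _) => q; lra.
have h5 := fl _ Xs.
rewrite h3 in h2; rewrite /potential /dualval.
move: (K _ _ _ _ _) (K _ _ _ _ _) (primalval z) h1 h2 h4 => k1 k2 k3; lra.
Qed.

(* Either half of the residual pays for the last term of [potential_step], or
   all residuals are [O(sqrt beta)], so that the error bound applies. *)
Lemma potential_decrease : exists2 beta', 0 < beta' &
  forall beta x z xp zp y yp, 0 < beta -> beta <= 1 -> beta < beta' ->
  X x -> X z -> X xp ->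
  (forall v, X v -> dotv (x - c *: gradK gamma p x z yp - xp) (v - xp) <= 0) ->
  yp = y + alpha *: (A *m x - b) -> zp = z + beta *: (xp - z) ->
  potential xp yp zp +
    (residual_weight * enorm (xp - x) ^+ 2
     + alpha * enorm (A *m dualx gamma p yp z - b) ^+ 2
     + p * beta / 4 * enorm (xp - z) ^+ 2) / 2 <= potential x y z.
Proof.
have [de de0 [ze ze0 EB]] := error_bound.
have [rho [C [rho0 C0 hol]]] := primal_holder.
have [D D0 XD] := compact_enorm_bounded Xcompact.
have a10 := residual_weight_gt0; set a1 := residual_weight in a10 *.
pose k := 2 / (c * (p - Lf)).
have m0 : 0 < c * (p - Lf) by rewrite mulr_gt0// modulus_gt0.
have k0 : 0 < k by rewrite divr_gt0.
have q0 : 0 < p / (p - Lf) by rewrite divr_gt0// modulus_gt0.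
(* With W = |x*(z) - x(yp, z)|, a residual below [d1] gives W <= de/18; a dominating error gives |xp
   - z| <= 8 W, and [d2] makes (1 + k) |xp - x| <= de/2. Then |z - x*(z)| <= 9 de/18 + de/2 = de. *)
pose d1 := Num.min (Num.min de rho) ((de / 18) ^+ 2 / C).
pose d2 := de / 2 / (1 + k).
have d10 : 0 < d1 by rewrite !lt_min de0 rho0 divr_gt0 ?exprn_gt0 ?divr_gt0.
have d20 : 0 < d2 by rewrite !divr_gt0// ltr_wpDl.
have pD0 : 0 < 16 * p * D ^+ 2 by rewrite !mulr_gt0 ?exprn_gt0.
(* [b1] is the smallness asked by [potential_step]; [b2] and [b3] force the residual and the step
   below [d1] and [d2] when the error dominates; [b4] lets half of alpha |r|^2 absorb the error once
   the error bound holds. *)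
pose b1 := (16 * (p / (p - Lf)))^-1.
pose b2 := alpha * d1 ^+ 2 / (16 * p * D ^+ 2).
pose b3 := a1 * d2 ^+ 2 / (16 * p * D ^+ 2).
pose b4 := alpha / (16 * p * ze ^+ 2).
have pz0 : 0 < 16 * p * ze ^+ 2 by rewrite !mulr_gt0 ?exprn_gt0.
exists (Num.min (Num.min b1 b2) (Num.min b3 b4)).
  have b10 : 0 < b1 by rewrite invr_gt0 mulr_gt0.
  have b20 : 0 < b2 by rewrite divr_gt0// mulr_gt0// exprn_gt0.
  have b30 : 0 < b3 by rewrite divr_gt0// mulr_gt0// exprn_gt0.
  have b40 : 0 < b4 by rewrite divr_gt0.
  by rewrite !lt_min b10 b20 b30 b40.
move=> beta x z xp zp y yp bt0 bt1; rewrite !lt_min.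
move=> /andP[/andP[bb1 bb2] /andP[bb3 bb4]] Xx Xz Xxp VI ypE zpE.
have bb1' : 16 * (p / (p - Lf)) * beta <= 1.
  by rewrite mulrC -ler_pdivlMr ?mul1r ?ltW// mulr_gt0.
have bb2' : beta * (16 * p * D ^+ 2) <= alpha * d1 ^+ 2 by rewrite -ler_pdivlMr// ltW.
have bb3' : beta * (16 * p * D ^+ 2) <= a1 * d2 ^+ 2 by rewrite -ler_pdivlMr// ltW.
have bb4' : beta * (16 * p * ze ^+ 2) <= alpha by rewrite -ler_pdivlMr// ltW.
have Pst := potential_step Xx Xxp VI ypE zpE bt0 bt1 bb1'.
rewrite -/a1 in Pst.
have dist := step_distance Xx Xxp VI; rewrite -/k in dist.
have [Xx1 _] := dualxP gamma p yp z feasX_nonempty.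
have x1E := dualx_primal yp z gamma_ge0 Lf_lt feasX_nonempty.
set x1 := dualx gamma p yp z in Pst dist Xx1 x1E *; set r := A *m x1 - b in Pst x1E *.
have Sr : slice r !=set0 by exists x1; split=> //; rewrite /r addrC subrK.
have [[Xs As] _] := primalP p z slice0_nonempty.
have WD : enorm (xs 0 z - x1) <= D by exact: XD.
have hold := hol r 0 z Xz Sr slice0_nonempty.
have EB' := EB z r Xz Sr.
rewrite -x1E subr0 enorm0 (enormBC x1) in hold EB'.
have tri : enorm (z - xs 0 z) <=
    enorm (xp - z) + (1 + k) * enorm (xp - x) + enorm (xs 0 z - x1).
  have t1 := enorm_triangle xp z (xs 0 z); have t2 := enorm_triangle x xp (xs 0 z).
  have t3 := enorm_triangle x1 x (xs 0 z).
  rewrite (enormBC z xp) in t1; rewrite (enormBC x1 (xs 0 z)) in t3.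
  apply: le_trans t1 _; rewrite -addrA lerD2l mulrDl mul1r -addrA.
  apply: le_trans t2 _; rewrite lerD2l; apply: le_trans t3 _.
  by rewrite lerD2r.
have W0 := enorm_ge0 (xs 0 z - x1); have s0 := enorm_ge0 (xp - x).
have w0 := enorm_ge0 (xp - z); have r0 := enorm_ge0 r.
move: Pst WD hold EB' tri W0 s0 w0 r0 {dist}.
move: (potential _ _ _) (potential _ _ _) => P1 P0.
move: (enorm (xs 0 z - x1)) (enorm (xp - x)) (enorm (xp - z)) (enorm r) => W s w nr.
move: (enorm (z - xs 0 z)) => t.
move=> Pst WD hold EB' tri W0 s0 w0 nr0.
have pb : 0 < p * beta by rewrite mulr_gt0.
have T1 : 0 <= a1 * s ^+ 2 by rewrite mulr_ge0 ?sqr_ge0 ?ltW.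
have T2 : 0 <= alpha * nr ^+ 2 by rewrite mulr_ge0 ?sqr_ge0 ?ltW.
have T3 : 0 <= p * beta / 4 * w ^+ 2 by rewrite mulr_ge0 ?sqr_ge0 ?divr_ge0 ?ltW.
have [le_half|] := leP (8 * p * beta * W ^+ 2)
    ((a1 * s ^+ 2 + alpha * nr ^+ 2 + p * beta / 4 * w ^+ 2) / 2); first by lra.
move=> gt_half.
have W2 : beta * (16 * p * W ^+ 2) <= beta * (16 * p * D ^+ 2).
  by rewrite ler_pM2l// ler_pM2l ?mulr_gt0// ler_pXn2r ?nnegrE ?(ltW D0).
have nr1 : nr <= d1.
  rewrite -(@ler_pXn2r _ 2) ?nnegrE ?(ltW d10)// -(ler_pM2l alpha_gt0).
  apply: le_trans bb2'; lra.
have s1 : s <= d2.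
  rewrite -(@ler_pXn2r _ 2) ?nnegrE ?(ltW d20)// -(ler_pM2l a10).
  apply: le_trans bb3'; lra.
have w1 : w <= 8 * W.
  rewrite -(@ler_pXn2r _ 2) ?nnegrE ?mulr_ge0// -(ler_pM2l pb); lra.
move: nr1; rewrite !le_min => /andP[/andP[nrde nrrho] nrC].
have W1 : W <= de / 18.
  rewrite -(@ler_pXn2r _ 2) ?nnegrE ?divr_ge0 ?(ltW de0)//.
  apply: le_trans (hold nrrho (ltW rho0)) _.
  by rewrite mulrC -ler_pdivlMr.
have ks : (1 + k) * s <= de / 2.
  by rewrite mulrC -ler_pdivlMr// ltr_wpDl.
have tde : t <= de by lra.
have Wz := EB' nrde tde.
have WW : W ^+ 2 <= (ze * nr) ^+ 2 by rewrite ler_pXn2r ?nnegrE ?mulr_ge0 ?(ltW ze0).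
rewrite exprMn in WW.
have h1 : 8 * p * beta * W ^+ 2 <= 8 * p * beta * (ze ^+ 2 * nr ^+ 2).
  by rewrite ler_wpM2l// !mulr_ge0 ?(ltW p_gt0) ?(ltW bt0).
have h2 : beta * (16 * p * ze ^+ 2) * nr ^+ 2 <= alpha * nr ^+ 2.
  by rewrite ler_wpM2r ?sqr_ge0.
lra.
Qed.

Variable flow : R.
Hypothesis f_bounded : forall x, X x -> flow < f x.

(** * Complexity and limit points of a run *)

Section Run.
Variable beta : R.
Hypotheses (beta_gt0 : 0 < beta) (beta_le1 : beta <= 1).
Variables (x : nat -> 'cV[R]_n) (y : nat -> 'cV[R]_m) (z : nat -> 'cV[R]_n).
Hypotheses (Xx0 : X (x 0%N)) (Xz0 : X (z 0%N)).
Hypothesis run : forall t,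
  [/\ y t.+1 = y t + alpha *: (A *m x t - b),
      x t.+1 = Defs.proj X
        (x t - c *: grad (fun u => K gamma p u (z t) (y t.+1)) (x t)) &
      z t.+1 = z t + beta *: (x t.+1 - z t)].
Hypothesis dec : forall x z xp zp y yp, X x -> X z -> X xp ->
  (forall v, X v -> dotv (x - c *: gradK gamma p x z yp - xp) (v - xp) <= 0) ->
  yp = y + alpha *: (A *m x - b) -> zp = z + beta *: (xp - z) ->
  potential xp yp zp +
    (residual_weight * enorm (xp - x) ^+ 2
     + alpha * enorm (A *m dualx gamma p yp z - b) ^+ 2
     + p * beta / 4 * enorm (xp - z) ^+ 2) / 2 <= potential x y z.

Lemma run_proj t : X (x t.+1) /\ forall v, X v ->
  dotv (x t - c *: gradK gamma p (x t) (z t) (y t.+1) - x t.+1) (v - x t.+1) <= 0.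
Proof.
have [_ xE _] := run t; rewrite grad_augK// -/(gradK _ _ _ _ _) in xE.
by rewrite xE; exact: projP Xcompact Xconvex feasX_nonempty.
Qed.

Lemma run_X t : X (x t). Proof. by case: t => // t; case: (run_proj t). Qed.

Lemma run_Z t : X (z t).
Proof.
elim: t => // t IH; have [_ _ zE] := run t.
by apply: (step_in_feasX IH (run_X t.+1) zE).
Qed.

Let s t := enorm (x t.+1 - x t).
Let r t := enorm (A *m dualx gamma p (y t.+1) (z t) - b).
Let w t := enorm (x t.+1 - z t).
Let res t := (residual_weight * s t ^+ 2 + alpha * r t ^+ 2 + p * beta / 4 * w t ^+ 2) / 2.

Lemma run_decrease t :
  potential (x t.+1) (y t.+1) (z t.+1) + res t <= potential (x t) (y t) (z t).
Proof.
have [yE _ zE] := run t; have [Xp VI] := run_proj t.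
exact: (dec (run_X t) (run_Z t) Xp VI yE zE).
Qed.

(** The added 1 makes it strictly positive, since [potential_ge] is not strict. *)
Definition run_budget := potential (x 0%N) (y 0%N) (z 0%N) - flow + 1.

Lemma run_budget_gt0 : 0 < run_budget.
Proof. by rewrite ltr_wpDl// subr_ge0; exact: potential_ge. Qed.

Lemma run_sum T : \sum_(0 <= t < T) res t <= run_budget.
Proof.
have : \sum_(0 <= t < T) res t + potential (x T) (y T) (z T) <=
    potential (x 0%N) (y 0%N) (z 0%N).
  elim: T => [|T IH]; first by rewrite big_geq// add0r.
  rewrite big_nat_recr//= -addrA; apply: le_trans IH; rewrite lerD2l addrC.
  exact: run_decrease.
have := potential_ge (y T) (z T) f_bounded (run_X T).
rewrite /run_budget; move: (\sum_(0 <= t < T) _) (potential _ _ _) (potential _ _ _).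
by move=> S P Q; lra.
Qed.

Lemma res_ge0 t : 0 <= res t.
Proof.
have a0 := residual_weight_gt0; have pb : 0 < p * beta by rewrite mulr_gt0.
by rewrite divr_ge0// !addr_ge0// mulr_ge0 ?sqr_ge0 ?divr_ge0 ?ltW.
Qed.

Lemma run_small t e : 0 <= e ->
  res t <= Num.min residual_weight (Num.min alpha (p * beta / 4)) / 2 * e ^+ 2 ->
  [/\ s t <= e, r t <= e & w t <= e].
Proof.
move=> e0; set k := Num.min _ _; rewrite /res.
have a0 := residual_weight_gt0; have pb : 0 < p * beta by rewrite mulr_gt0.
have s0 : 0 <= s t by exact: enorm_ge0.
have r0 : 0 <= r t by exact: enorm_ge0.
have w0 : 0 <= w t by exact: enorm_ge0.
have k0 : 0 < k by rewrite !lt_min a0 alpha_gt0 divr_gt0.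
have k1 : k <= residual_weight by rewrite ge_min lexx.
have k2 : k <= alpha by rewrite !ge_min lexx orbT.
have k3 : k <= p * beta / 4 by rewrite !ge_min lexx !orbT.
have h1 : k * s t ^+ 2 <= residual_weight * s t ^+ 2 by rewrite ler_wpM2r ?sqr_ge0.
have h2 : k * r t ^+ 2 <= alpha * r t ^+ 2 by rewrite ler_wpM2r ?sqr_ge0.
have h3 : k * w t ^+ 2 <= p * beta / 4 * w t ^+ 2 by rewrite ler_wpM2r ?sqr_ge0.
have g1 : 0 <= k * s t ^+ 2 by rewrite mulr_ge0 ?sqr_ge0 ?ltW.
have g2 : 0 <= k * r t ^+ 2 by rewrite mulr_ge0 ?sqr_ge0 ?ltW.
have g3 : 0 <= k * w t ^+ 2 by rewrite mulr_ge0 ?sqr_ge0 ?ltW.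
move: h1 h2 h3 g1 g2 g3 s0 r0 w0; move: (s t) (r t) (w t) => a1 a2 a3.
move=> h1 h2 h3 g1 g2 g3 s0 r0 w0 le_k.
by split; rewrite -(@ler_pXn2r _ 2) ?nnegrE// -(ler_pM2l k0); lra.
Qed.

Lemma run_rate : exists C, 0 < C /\ forall eps, 0 < eps -> eps <= 1 ->
  exists t : nat, t%:R <= C / eps ^+ 2 /\ eps_stationary A b f h eps (x t).
Proof.
have B0 := run_budget_gt0; have S0 := stationarity_const_gt0.
set k := Num.min residual_weight (Num.min alpha (p * beta / 4)) / 2.
have k0 : 0 < k.
  by rewrite divr_gt0// !lt_min residual_weight_gt0 alpha_gt0 divr_gt0// mulr_gt0.
pose C := run_budget / k * (3 * stationarity_const) ^+ 2.
have C0 : 0 < C.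
  by apply: mulr_gt0; [exact: divr_gt0|rewrite exprn_gt0// mulr_gt0].
(* The stationary iterate is [t.+1] with t below T = floor(C/eps^2) + 1, so its index may exceed
   C/eps^2 by up to 1, and 1 <= 1/eps^2. *)
exists (C + 1); split=> [|eps e0 e1]; first by rewrite addr_gt0.
have ee0 : 0 < eps ^+ 2 by rewrite exprn_gt0.
have Ce : 0 <= C / eps ^+ 2 by rewrite divr_ge0 ?ltW.
pose T := (Num.truncn (C / eps ^+ 2)).+1.
have /andP[T1 T2] := truncn_itv Ce.
have T0 : 0 < T%:R :> R by rewrite ltr0n.
(* The first T residuals sum to at most the budget, so one of them is at most its T-th part. *)
have [t tT rest] : exists2 t, (t < T)%N & res t <= run_budget / T%:R.
  apply: contrapT => H; have := run_sum T; rewrite leNgt => /negP; apply.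
  have -> : run_budget = \sum_(0 <= t < T) run_budget / T%:R.
    by rewrite sumr_const_nat subn0 -[_ *+ T]mulr_natr divfK ?gt_eqF.
  apply: ltr_sum_nat => // t /andP[_ tT].
  by rewrite ltNge; apply/negP => le; apply: H; exists t.
exists t.+1; split.
  rewrite mulrDl mul1r (@le_trans _ _ T%:R) ?ler_nat//.
  rewrite -natr1; apply: lerD => //.
  by rewrite invf_ge1// expr_le1// ltW.
pose e := eps / (3 * stationarity_const).
have S30 : 0 < 3 * stationarity_const by rewrite mulr_gt0.
have e00 : 0 < e by rewrite divr_gt0.
have [||se re we] := @run_small t e; first exact: ltW.
  apply: le_trans rest _; rewrite -/k ler_pdivrMr//.
  have CT : C <= T%:R * eps ^+ 2 by rewrite -ler_pdivrMr// ltW.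
  have -> : k * e ^+ 2 * T%:R = k * (T%:R * eps ^+ 2) / (3 * stationarity_const) ^+ 2.
    by rewrite /e expr_div_n; field; rewrite gt_eqF.
  rewrite ler_pdivlMr ?exprn_gt0//.
  have -> : run_budget * (3 * stationarity_const) ^+ 2 = k * C.
    have kB : k * (run_budget / k) = run_budget by rewrite mulrC divfK// gt_eqF.
    by rewrite /C [RHS]mulrA kB.
  by rewrite ler_pM2l.
have [yE _ zE] := run t; have [Xp VI] := run_proj t.
apply: (step_stationary (run_X t) Xp VI).
have -> : eps = stationarity_const * (e + e + e).
  by rewrite /e; field; rewrite gt_eqF.
by rewrite ler_pM2l// lerD// lerD.
Qed.

Lemma run_vanish e : 0 < e -> exists N, forall t, (N <= t)%N ->
  [/\ s t <= e, r t <= e & w t <= e].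
Proof.
move=> e0.
have cs : cvgn (series res).
  apply: nondecreasing_is_cvgn.
    apply/nondecreasing_seqP => t; rewrite /series /= big_nat_recr//= lerDl.
    exact: res_ge0.
  exists run_budget => _ [T _ <-]; exact: run_sum.
set k := Num.min residual_weight (Num.min alpha (p * beta / 4)) / 2.
have k0 : 0 < k * e ^+ 2.
  rewrite mulr_gt0 ?exprn_gt0// divr_gt0// !lt_min residual_weight_gt0 alpha_gt0.
  by rewrite divr_gt0// mulr_gt0.
have /cvgrPdist_le/(_ _ k0)[N _ HN] := cvg_series_cvg_0 cs.
exists N => t Nt; apply: run_small; first exact: ltW.
by have := HN t Nt; rewrite /= sub0r normrN ger0_norm// res_ge0.
Qed.

(** For each e, one iterate near the cluster point with residuals below e suffices: the
    infeasibility of the limit and the violation of its variational inequality are then O(e), with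
    no subsequence to extract. *)
Lemma run_limit xb yb :
  cluster ((fun t => (x t, y t)) @ \oo) (xb, yb) -> KKT_point A b f h xb yb.
Proof.
move=> cl.
have near_run e N : 0 < e -> exists t,
    [/\ (N <= t)%N, enorm (x t - xb) < e & enorm (y t - yb) < e].
  move=> e0.
  have [||_ [[t /= Nt <-] [/= xe ye]]] := cl [set u | exists2 t, (N <= t)%N & (x t, y t) = u]
      ([set u | enorm (u - xb) < e] `*` [set u | enorm (u - yb) < e]).
  - by exists N => // t /= Nt; exists t.
  - exists ([set u | enorm (u - xb) < e], [set u | enorm (u - yb) < e]) => //=.
    by split; apply/near_enormP; exists e.
  by exists t.
have Xxb : X xb.
  apply: (compact_closed _ Xcompact) => [|B /near_enormP[e e0 eB]].
    exact: norm_hausdorff.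
  have [t [_ xe _]] := near_run e 0%N e0.
  by exists (x t); split; [exact: run_X|exact: eB].
have approx e : 0 < e -> exists t, [/\ enorm (x t - xb) <= e, enorm (y t - yb) <= e,
    s t <= e, r t <= e & w t <= e].
  move=> e0; have [N HN] := run_vanish e0.
  have [t [Nt xe ye]] := near_run e N e0; have [se re we] := HN t Nt.
  by exists t; split => //; exact: ltW.
have sg := sigma_max_ge0 A.
have small (a M : R) : 0 <= M -> (forall e, 0 < e -> a <= M * e) -> a <= 0.
  move=> M0 aM; apply/ler_addgt0Pr => e e0; rewrite add0r.
  have M1 : 0 < M + 1 by rewrite ltr_wpDl.
  apply: le_trans (aM (e / (M + 1)) _) _; first by rewrite divr_gt0.
  by rewrite mulrCA ler_piMr ?(ltW e0)// ler_pdivrMr// mul1r lerDl.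
have Ab : A *m xb = b.
  apply: subr0_eq; apply: enorm_eq0; apply/eqP; rewrite eq_le enorm_ge0 andbT.
  apply: (small _ (limit_const + sigma_max A)).
    by rewrite addr_ge0// ltW// limit_const_gt0.
  move=> e e0; have [t [xe _ se re _]] := approx e e0.
  have [Xp VI] := run_proj t.
  exact: (step_limit_feasible (run_X t) Xp VI xe se re).
apply: limit_VI_KKT => // v Xv; rewrite -oppr_le0.
have [D D0 XD] := compact_enorm_bounded Xcompact.
have ls0 : 0 <= limit_slope.
  have lc := ltW limit_const_gt0; have al := mulr_ge0 (ltW alpha_gt0) lc.
  apply: addr_ge0; last by rewrite invr_ge0 ltW.
  apply: addr_ge0; last by rewrite mulr_ge0// ltW.
  apply: addr_ge0; last exact: mulr_ge0 (mulr_ge0 sg lc).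
  by apply: addr_ge0 => //; apply: mulr_ge0 => //; exact: addr_ge0.
apply: (small _ (limit_slope * D + 2 * enorm (grad f xb + A^T *m yb))).
  by rewrite addr_ge0 ?mulr_ge0 ?enorm_ge0 ?(ltW D0).
move=> e e0; have [t [xe ye se re we]] := approx e e0.
have [Xp VI] := run_proj t; have [yE _ _] := run t.
rewrite lerNl.
exact: (step_limit_VI (run_X t) Xp VI yE Xxb Xv (XD _ _ Xv Xp) xe ye se re we).
Qed.

End Run.

Lemma ALM_convergence x0 z0 y0 : X x0 -> X z0 ->
  exists beta' : R, 0 < beta' /\
    forall beta : R, 0 < beta -> beta <= 1 -> beta < beta' ->
    forall (x : nat -> 'cV[R]_n) (y : nat -> 'cV[R]_m) (z : nat -> 'cV[R]_n),
    smoothed_prox_ALM A b f h gamma p c alpha beta x0 z0 y0 x y z ->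
    (forall (xb : 'cV[R]_n) (yb : 'cV[R]_m),
       cluster ((fun t => (x t, y t)) @ \oo) (xb, yb) -> KKT_point A b f h xb yb) /\
    (exists C : R, 0 < C /\
       forall eps : R, 0 < eps -> eps <= 1 ->
       exists t : nat, t%:R <= C / eps ^+ 2 /\
         eps_stationary A b f h eps (x t)).
Proof.
move=> Xx0 Xz0; have [beta' beta'0 dec] := potential_decrease.
exists beta'; split=> // beta beta0 beta1 beta_lt x y z [x0E _ z0E run].
rewrite -x0E in Xx0; rewrite -z0E in Xz0.
have {}dec := fun x z xp zp y yp => dec beta x z xp zp y yp beta0 beta1 beta_lt.
split; first by move=> xb yb; exact: (run_limit beta0 beta1 Xx0 Xz0 run dec).
exact: (run_rate beta0 beta1 Xx0 Xz0 run dec).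
Qed.

End Landscape.

(** * Sign of the Lipschitz constant and the final theorem *)

(** The Slater point is interior to X, so in positive dimension X has two distinct points, and a
    negative constant would bound a norm by a negative number. *)
Lemma slater_lipschitz_ge0 (R : realType) m n l (A : 'M[R]_(m, n.+1)) b
    (f : 'cV[R]_n.+1 -> R) (h : 'I_l -> 'cV[R]_n.+1 -> R) L :
  (forall i x, differentiable (h i) x) -> slater A b h ->
  lipschitz_grad f L (feasX h) -> 0 <= L.
Proof.
move=> dh [x [_ hx]] Lf.
have /near_enormP[e e0 eh] := slater_ball dh hx.
pose d : 'cV[R]_n.+1 := (e / 2 / (enorm (const_mx 1 : 'cV[R]_n.+1) + 1)) *: const_mx 1.
have c0 := enorm_ge0 (const_mx 1 : 'cV[R]_n.+1).
have d0 : 0 < enorm d.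
  rewrite lt_def enorm_ge0 andbT; apply/negP => /eqP/enorm_eq0/matrixP/(_ 0 0).
  rewrite !mxE mulr1 => /eqP; rewrite gt_eqF// !divr_gt0//; lra.
have de : enorm d < e.
  rewrite enormZ ger0_norm; last by rewrite !divr_ge0 ?addr_ge0 ?(ltW e0).
  rewrite mulrAC ltr_pdivrMr; last by lra.
  move: (enorm (const_mx 1)) c0 => k k0; nra.
have Xd : feasX h (x + d) by move=> i; apply/ltW/eh; rewrite addrC addKr.
have Xx : feasX h x by move=> i; exact: ltW.
have := Lf _ _ Xd Xx; have -> : x + d - x = d by rewrite addrC addKr.
by move=> /(le_trans (enorm_ge0 _)); rewrite pmulr_lge0.
Qed.

Theorem theorem1 (R : realType) (m n l : nat)
    (A : 'M[R]_(m, n)) (b : 'cV[R]_m)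
    (f : 'cV[R]_n -> R) (h : 'I_l -> 'cV[R]_n -> R) (flow Lf Lh : R)
    (Xcompact : compact (feasX h))
    (Xconvex : @convex_set R 'cV[R]_n (feasX h))
    (f_smooth : smooth f)
    (f_bounded : forall x, feasX h x -> flow < f x)
    (f_lipschitz : lipschitz_grad f Lf (feasX h))
    (h_smooth : forall i, smooth (h i))
    (h_convex : forall i, @convex_function R 'cV[R]_n setT (h i))
    (h_lipschitz : forall i, lipschitz_grad (h i) Lh setT)
    (h_slater : slater A b h)
    (h_crcq : CRCQ A b f h)
    (x0 z0 : 'cV[R]_n) (y0 : 'cV[R]_m)
    (x0X : feasX h x0) (z0X : feasX h z0)
    (p gamma c alpha : R)
    (p_gt0 : 0 < p) (p_ge : 3 * Lf <= p)
    (gamma_ge0 : 0 <= gamma)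
    (c_gt0 : 0 < c) (c_lt : c < 1 / (Lf + gamma * sigma_max A ^+ 2 + p))
    (alpha_gt0 : 0 < alpha)
    (alpha_lt : sigma_max A != 0 ->
       alpha < c * (p - Lf) ^+ 2 / (4 * sigma_max A ^+ 2)) :
  exists beta' : R, 0 < beta' /\
    forall beta : R, 0 < beta -> beta <= 1 -> beta < beta' ->
    forall (x : nat -> 'cV[R]_n) (y : nat -> 'cV[R]_m) (z : nat -> 'cV[R]_n),
    smoothed_prox_ALM A b f h gamma p c alpha beta x0 z0 y0 x y z ->
    (forall (xbar : 'cV[R]_n) (ybar : 'cV[R]_m),
       cluster ((fun t => (x t, y t)) @ \oo) (xbar, ybar) ->
       KKT_point A b f h xbar ybar) /\
    (exists C : R, 0 < C /\
       forall eps : R, 0 < eps -> eps <= 1 ->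
       exists t : nat, t%:R <= C / eps ^+ 2 /\
         eps_stationary A b f h eps (x t)).
Proof.
have h_diff i u : differentiable (h i) u by case: (h_smooth i).
have f_diff u : differentiable f u by case: f_smooth.
(* In dimension 0 the constant [Lf] may be negative, so that case is apart. *)
case: n A b f h Xcompact Xconvex f_bounded f_lipschitz h_convex h_lipschitz
  h_slater h_crcq x0 z0 x0X z0X c_lt alpha_lt h_diff f_diff
  {f_smooth h_smooth} => [|k] A' b' f' h' Xcpt Xcvx fb flip hcvx hlip slat crcq.
  move=> x0' z0' Xx0 _ _ _ _ _; exists 1; split=> // beta _ _ _ x y z [xE _ _ _].
  have [u [Au hu]] := slat.
  have eq0 (v : 'cV[R]_0) : v = u by rewrite [v]flatmx0 [u]flatmx0.
  split=> [xb yb _|].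
    exists (fun=> 0); split; first by rewrite [LHS]flatmx0.
      by rewrite (eq0 xb).
    by move=> i; rewrite mul0r (eq0 xb); split=> //; exact: ltW.
  exists 1; split=> // eps e0 _; exists 0%N; split.
    by rewrite divr_ge0// sqr_ge0.
  have Xx : feasX h' (x 0%N) by rewrite xE.
  split=> //; exists 0, 0; split.
  - exists 0; last by rewrite [RHS]flatmx0.
    by apply/subdifferential_indicatorP => // v _; rewrite dotv0l.
  - by rewrite enorm0 ltW.
  - by rewrite (eq0 (x 0%N)) Au subrr enorm0 ltW.
move=> x0' z0' Xx0 Xz0 clt alt hd fd.
have Lf0 := slater_lipschitz_ge0 hd slat flip.
have Lfp : Lf < p by lra.
have s0 := sqr_ge0 (sigma_max A').
have c1 : c * (Lf + gamma * sigma_max A' ^+ 2 + p) < 1.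
  have gs := mulr_ge0 gamma_ge0 s0.
  rewrite -ltr_pdivlMr//; move: gs; move: (gamma * _) => g; lra.
have a1 : 4 * alpha * sigma_max A' ^+ 2 < c * (p - Lf) ^+ 2.
  (* For a zero singular value the bound on alpha, cleared of its denominator, reads 0 < c (p -
     Lf)^2. *)
  have [sg|sg] := eqVneq (sigma_max A') 0.
    by rewrite sg expr0n mulr0 mulr_gt0// exprn_gt0// subr_gt0.
  have := alt sg; rewrite ltr_pdivlMr; first by lra.
  by rewrite mulr_gt0// exprn_even_gt0.
exact: (ALM_convergence Xcpt Xcvx fd flip Lf0 hd slat p_gt0 Lfp hcvx hlip crcq
  gamma_ge0 c_gt0 c1 alpha_gt0 a1 fb y0 Xx0 Xz0).
Qed.
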